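(* Let $d\ge 1$ and let $\Pi$ be any translation-invariant ergodic simple point process of unit intensity on $\mathbb{R}^d$. Then there exists a nonrandomized (continuum) extra head scheme for $\Pi$; that is, there exists an $\mathbb{R}^d$-valued random variable $Y$ which is almost surely equal to a (deterministic, measurable) function of $\Pi$ and such that $T^{-Y}\Pi$ has the same law as the Palm version $\Pi^*$ of $\Pi$.
   Context: Integer-valued (locally finite) Borel measures on $\mathbb{R}^d$ are called configurations; a point process is a random configuration, and it is simple if almost surely every atom has mass $1$. For $y\in\mathbb{R}^d$ and a configuration $\pi$, the translated configuration $T^{-y}\pi$ is $(T^{-y}\pi)(\cdot)=\pi(\cdot+y)$. Translation-invariance and ergodicity are with respect to the group of all translations of $\mathbb{R}^d$. Let $\Lambda$ be the law of $\Pi$. The Palm version $\Pi^*$ of $\Pi$, with law $\Lambda^*$, is characterized by $$\mathbf{E}\int_B f(T^{-s}\Pi)\,\Pi(ds)=\mathcal{L}(B)\,\mathbf{E}f(\Pi^* )$$ for every bounded measurable function $f$ on configurations and every Borel $B\subseteq\mathbb{R}^d$, where $\mathcal{L}$ is Lebesgue measure. A (continuum) extra head scheme for $\Pi$ is an $\mathbb{R}^d$-valued random variable $Y$ (on some joint probability space with $\Pi$) such that the point process $T^{-Y}\Pi$ has law $\Lambda^*$. It is nonrandomized if $Y$ is almost surely a function of $\Pi$. *)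

(* Defs.v *)
From HB Require Import structures.
From mathcomp Require Import all_boot all_order all_algebra.
From mathcomp Require Import all_classical all_reals all_analysis.
From mathcomp Require Import measurable_realfun.

Set Implicit Arguments.
Unset Strict Implicit.
Unset Printing Implicit Defensive.

Import Order.TTheory GRing.Theory Num.Theory.
Import numFieldNormedType.Exports.

Local Open Scope classical_set_scope.
Local Open Scope ring_scope.
Local Open Scope ereal_scope.

(* The Borel sigma-algebra on matrices, hence on R^d = 'rV[R]_d. *)
HB.instance Definition _ (R : realType) (m n : nat) :=
  @isMeasurable.Build (sigma_display (@open 'M[R]_(m, n))) 'M[R]_(m, n)
    <<s @open 'M[R]_(m, n) >> (@sigma_algebra0 _ setT _)
    (@sigma_algebraC _ _) (@sigma_algebra_bigcup _ setT _).

(* Lebesgue measure on Borel subsets of R^d, as the iterated product of d copies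
   of the one-dimensional Lebesgue measure (Cavalieri's principle):
   L_{d+1}(A) is the integral over t of L_d {x | (t, x) \in A}. *)
Fixpoint lebesgue_rV (R : realType) (d : nat) : set 'rV[R]_d -> \bar R :=
  match d return set 'rV[R]_d -> \bar R with
  | 0 => fun A => \d_(0%R : 'rV[R]_0) A
  | d'.+1 => fun A => \int[@lebesgue_measure R]_t
      lebesgue_rV [set x : 'rV[R]_d' | A (row_mx (t%:M : 'rV[R]_1) x)]
  end.

(* The underlying set function is only meaningful on Borel sets: on other sets
   its values are irrelevant, and no event defined below can see them. *)
Record config (R : realType) (d : nat) := Config {
  config_measure :> {measure set 'rV[R]_d -> \bar R} ;
  config_locally_finite : forall B : set 'rV[R]_d,
    measurable B -> bounded_set B -> config_measure B < +oo ;
  config_integer_valued : forall B : set 'rV[R]_d, measurable B ->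
    config_measure B = +oo \/ exists n : nat, config_measure B = n%:R%:E }.

Section config_measurable.
Context (R : realType) (d : nat).

Definition config0 : config R d.
Proof.
exists mzero => [B _ _|B _] /=; first by rewrite /mzero ltry.
by right; exists 0%N.
Defined.

HB.instance Definition _ := gen_eqMixin (config R d).
HB.instance Definition _ := gen_choiceMixin (config R d).
HB.instance Definition _ := isPointed.Build (config R d) config0.

(* The sigma-algebra on configurations is the one generated by the evaluations
   pi |-> pi B, for B Borel. *)
Definition config_events : set (set (config R d)) :=
  \bigcup_(B in @measurable _ 'rV[R]_d)
    preimage_set_system [set: config R d] (fun pi => pi B) measurable.

HB.instance Definition _ :=
  @isMeasurable.Build (sigma_display config_events) (config R d)
    <<s config_events >> (@sigma_algebra0 _ setT _)
    (@sigma_algebraC _ _) (@sigma_algebra_bigcup _ setT _).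

End config_measurable.

Section translation.
Context (R : realType) (d : nat).
Implicit Types (y : 'rV[R]_d) (pi : config R d).

Lemma open_preimage_subr y (U : set 'rV[R]_d) :
  open U -> open ((fun x => x - y)%R @^-1` U).
Proof.
move=> oU; apply: open_comp oU => x _.
exact: (continuousB (@cvg_id _ _) (@cvg_cst _ _ _ _ _)).
Qed.

Lemma measurable_subr y :
  measurable_fun [set: 'rV[R]_d] (fun x : 'rV[R]_d => x - y)%R.
Proof.
apply: (measurability (@open 'rV[R]_d)) => //.
move=> _ [U oU <-]; rewrite setTI.
by apply: sub_sigma_algebra; exact: open_preimage_subr.
Qed.

Lemma bounded_preimage_subr y (B : set 'rV[R]_d) :
  bounded_set B -> bounded_set ((fun x => x - y)%R @^-1` B).
Proof.
move=> [M [_ BM]]; exists (M + `|y|)%R; split=> [|N MN x /= Bx].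
  exact: num_real.
rewrite -(subrK y x) (le_trans (ler_normD _ _))// -lerBrDr.
by apply: BM Bx; rewrite ltrBrDr.
Qed.

Let measurable_preimage_subr y (B : set 'rV[R]_d) :
  measurable B -> measurable ((fun x => x - y)%R @^-1` B).
Proof. by move=> mB; rewrite -[X in measurable X]setTI; exact: measurable_subr. Qed.

Definition translate_measure y pi : set 'rV[R]_d -> \bar R :=
  pushforward pi (fun x : 'rV[R]_d => x - y)%R.

HB.instance Definition _ y pi := Measure.copy (translate_measure y pi)
  (measure_function_pushforward__canonical__measure_function_Measure
    pi (measurable_subr y)).

Let translate_locally_finite y pi (B : set 'rV[R]_d) :
  measurable B -> bounded_set B -> translate_measure y pi B < +oo.
Proof.
by move=> mB bB; apply: config_locally_finite;
  [exact: measurable_preimage_subr | exact: bounded_preimage_subr].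
Qed.

Let translate_integer_valued y pi (B : set 'rV[R]_d) : measurable B ->
  translate_measure y pi B = +oo \/
  exists n : nat, translate_measure y pi B = n%:R%:E.
Proof.
by move=> mB; apply: config_integer_valued; exact: measurable_preimage_subr.
Qed.

(* translate y pi is the configuration T^{-y} pi : B |-> pi (B + y). *)
Definition translate y pi : config R d :=
  @Config R d (translate_measure y pi)
    (@translate_locally_finite y pi) (@translate_integer_valued y pi).

End translation.

Section point_process.
Context (R : realType) (d : nat) {disp : measure_display}
  {Omega : measurableType disp} (P : probability Omega R).
Implicit Type Pi : {RV P >-> config R d}.

Definition simple_process Pi : Prop :=
  {ae P, forall w, forall x : 'rV[R]_d,
    Pi w [set x] != 0 -> Pi w [set x] = 1}.

Definition unit_intensity Pi : Prop :=
  forall B : set 'rV[R]_d, measurable B -> \int[P]_w Pi w B = lebesgue_rV B.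

Definition translation_invariant Pi : Prop :=
  forall (y : 'rV[R]_d) (A : set (config R d)), measurable A ->
    P [set w | A (translate y (Pi w))] = P [set w | A (Pi w)].

Definition ergodic Pi : Prop :=
  forall A : set (config R d), measurable A ->
    (forall y pi, A (translate y pi) <-> A pi) ->
    distribution P Pi A = 0 \/ distribution P Pi A = 1.

(* L is the law of the Palm version of Pi. When B has infinite volume, only
   nonnegative f are considered: otherwise the integral of f over B need not
   make sense, and the equation would rest on conventions about oo - oo. *)
Definition palm_law Pi (L : probability (config R d) R) : Prop :=
  forall (f : config R d -> R) (B : set 'rV[R]_d),
    measurable_fun [set: config R d] f ->
    (exists M : R, forall pi, (`|f pi| <= M)%R) ->
    measurable B ->
    (forall pi, (0 <= f pi)%R) \/ lebesgue_rV B < +oo ->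
    \int[P]_w \int[Pi w]_(s in B) (f (translate s (Pi w)))%:E =
    lebesgue_rV B * \int[L]_pi (f pi)%:E.

(* T^{-Y} Pi is a point process whose law is the Palm law of Pi; the latter is
   uniquely determined by palm_law. *)
Definition extra_head_scheme Pi (Y : {RV P >-> 'rV[R]_d}) : Prop :=
  measurable_fun [set: Omega] (fun w => translate (Y w) (Pi w)) /\
  exists2 L : probability (config R d) R, palm_law Pi L &
    forall A : set (config R d), measurable A ->
      P [set w | A (translate (Y w) (Pi w))] = L A.

Definition nonrandomized Pi (Y : {RV P >-> 'rV[R]_d}) : Prop :=
  exists2 F : config R d -> 'rV[R]_d, measurable_fun [set: config R d] F &
    {ae P, forall w, Y w = F (Pi w)}.

End point_process.

(* Main.v *)
Require Import Defs.
From HB Require Import structures.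
From mathcomp Require Import all_boot all_order all_algebra.
From mathcomp Require Import all_classical all_reals all_analysis.
From mathcomp Require Import measurable_realfun lra.

(** Let [lam] be Lebesgue measure and, for a configuration [p], write T^{-y} p
for [translate y p]. The extra head scheme comes from a balanced allocation:
every site [u] of R^d is assigned to a point of [p], in a
translation-equivariant way, so that every point receives a set of sites of
volume exactly 1. The variable [Y] is the point to which the origin is
assigned.

The allocation is greedy. Fix an enumeration [rcball k] of the closed balls
with rational centre and radius 1/(m+1). At stage [k] an unassigned site [u]
proposes to the point [s] of [p] when [s - u] is the only point of T^{-u} p in
[rcball k]; a point accepts all its proposals if the volume it has been
assigned would remain at most 1, and otherwise rejects all of them
([newly], [load]). No point is assigned more than volume 1 ([load_le1]).
Conversely, if some point has volume less than 1 in the end, then no site is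
left out: at the stage of a small enough ball isolating that point as seen from
an unassigned site, the site would have proposed to the point, and the volume
of all proposals made to the point would have been small enough to be accepted
([unfilled_assigned]). Hence the translation-invariant event that some point is
deficient is contained in the event that the origin is assigned. By ergodicity
the first event has probability 0 or 1, and comparing volumes by mass
transport shows that almost surely no point is deficient and the origin is
assigned ([everassigned_as]).

The mass transport principle ([mass_transport]) rests on Fubini's theorem and
on the invariance of [lam] and of the law of the process. Applied to the
function [f] of the configuration seen from the point of the origin, it gives
lam(B) E f(T^{-Y} Pi) = E int_B f(T^{-s} Pi) Pi(ds) for nonnegative [f]
([head_palm_identity]), which is the equation defining the Palm law.

Lebesgue measure enters only as the mean measure of the process. This makes it
countably additive and translation invariant at once, and its value on balls is
the only thing to be computed from the iterated integrals
([lebesgue_rV_cball0]). *)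

Set Implicit Arguments.
Unset Strict Implicit.
Unset Printing Implicit Defensive.

Import Order.TTheory GRing.Theory Num.Theory.
Import numFieldNormedType.Exports.

Local Open Scope classical_set_scope.
Local Open Scope ring_scope.

(** * Balls and the Borel structure of R^d *)

Section balls.
Context (R : realType) (d : nat).
Notation V := 'rV[R]_d.

(** Closed ball for the norm of ['rV[R]_d], which is the sup norm: a cube. *)
Definition cball (z : V) (r : R) : set V := [set x | `|x - z| <= r].

Lemma rV_norm_le (x : V) (r : R) : 0 <= r ->
  (`|x| <= r) <-> (forall i, `|x 0 i| <= r).
Proof.
move=> r0; rewrite [`|x|]/Num.norm /= mx_normrE; split.
  by move=> /bigmax_leP[_ h] i; exact: (h (0, i)).
by move=> h; apply/bigmax_leP; split => // -[i j] _ /=; rewrite (ord1 i).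
Qed.

Lemma open_cballC z r : open (~` cball z r).
Proof.
have -> : ~` cball z r = (fun x : V => `|x - z|) @^-1` [set t | r < t].
  by apply/seteqP; split => x; rewrite /cball /= ltNge => /negP.
apply: open_comp; last exact: open_gt.
move=> x _; apply: continuous_comp; last exact: norm_continuous.
exact: (continuousB (@cvg_id _ _) (@cvg_cst _ _ _ _ _)).
Qed.

Lemma measurable_open (U : set V) : open U -> measurable U.
Proof. by move=> oU; apply: sub_sigma_algebra. Qed.

Lemma measurable_cball z r : measurable (cball z r).
Proof.
rewrite -[cball _ _]setCK; apply: measurableC; apply: measurable_open.
exact: open_cballC.
Qed.

Lemma bounded_cball z r : bounded_set (cball z r).
Proof.
exists (r + `|z|); split=> [|N MN x /= xz]; first exact: num_real.
rewrite -(subrK z x) (le_trans (ler_normD _ _))// (le_trans _ (ltW MN))//.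
by rewrite lerD2r.
Qed.

Lemma rat_approx (x : V) (e : R) : 0 < e ->
  exists q : 'rV[rat]_d, `|x - map_mx ratr q| <= e.
Proof.
move=> e0.
have h i : {q : rat | `|x 0 i - ratr q| <= e}.
  have lt : x 0 i - e < x 0 i by rewrite ltrBlDr ltrDl.
  apply: cid; have [q] := rat_in_itvoo lt.
  rewrite in_itv /= => /andP[h1 h2]; exists q.
  rewrite ger0_norm ?subr_ge0 ?(ltW h2)//.
  by rewrite lerBlDr -lerBlDl ltW.
exists (\row_i sval (h i)); apply/rV_norm_le; first exact: ltW.
by move=> i; rewrite !mxE; exact: (svalP (h i)).
Qed.

(** The [k]-th closed ball with rational centre and radius 1/(m+1), under the
enumeration of pairs (centre, m) given by [unpickle]; codes of no pair give
the ball of centre 0 and radius 1. *)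
Definition ball_center (k : nat) : V :=
  map_mx ratr (odflt (0, 0%N) (unpickle k : option ('rV[rat]_d * nat))).1.
Definition ball_radius (k : nat) : R :=
  (odflt (0, 0%N) (unpickle k : option ('rV[rat]_d * nat))).2.+1%:R^-1.

Definition rcball (k : nat) : set V := cball (ball_center k) (ball_radius k).

(** The balls [rcball k] containing a given point can be chosen arbitrarily
small. *)
Lemma rcball_small (z : V) (e : R) : 0 < e ->
  exists k, [/\ rcball k z, rcball k `<=` cball z e & ball_radius k <= e].
Proof.
move=> e0.
have [m hm] : exists m : nat, (m.+1%:R^-1 : R) <= e / 2.
  have e20 : 0 < e / 2 by rewrite divr_gt0.
  have [m _ hm] := near_infty_natSinv_lt (PosNum e20).
  by exists m; apply: ltW; exact: (hm m (leqnn m)).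
have m0 : 0 < (m.+1%:R^-1 : R) by rewrite invr_gt0.
have [q hq] := rat_approx z m0.
exists (pickle (q, m)); rewrite /rcball /ball_center /ball_radius pickleK /=.
split=> //; last by rewrite (le_trans hm)// ler_pdivrMr// ler_peMr ?ler1n// ltW.
move=> x; rewrite /cball /= => hx.
rewrite (_ : x - z = (x - map_mx ratr q) - (z - map_mx ratr q)); last first.
  by rewrite opprB addrA subrK.
rewrite (le_trans (ler_normB _ _))// (le_trans (lerD hx hq))//.
by rewrite (splitr e) lerD.
Qed.

(** Subtraction is measurable for the product of the two Borel sigma-algebras,
and not only for the Borel sigma-algebra of the product: an open set of pairs
is a countable union of products of balls. *)
Lemma measurable_sub_rV : measurable_fun setT (fun x : V * V => x.1 - x.2).
Proof.
apply: (measurability (@open V)) => //.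
move=> _ [U oU <-]; rewrite setTI.
pose A := fun jk : nat * nat => [set z : V * V | rcball jk.1 z.1 /\
  rcball jk.2 z.2 /\ rcball jk.1 `*` rcball jk.2 `<=` (fun x => x.1 - x.2) @^-1` U].
have -> : (fun x : V * V => x.1 - x.2) @^-1` U = \bigcup_jk A jk.
  apply/seteqP; split => [[x y] /= Uxy|[x y] [[j k] _ [/= hx [hy]]]]; last first.
    by move=> /(_ (x, y)); apply.
  have /nbhs_ballP[e /= e0 he] : nbhs (x - y) U by exact: open_nbhs_nbhs.
  have e30 : 0 < e / 3 by rewrite divr_gt0.
  have [j [jx sj _]] := rcball_small x e30.
  have [k [ky sk _]] := rcball_small y e30.
  exists (j, k) => //; split => //; split => //= -[x' y'] [/= /sj xx' /sk yy'].
  apply: he; rewrite -ball_normE /ball_ /= distrC.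
  rewrite (_ : x' - y' - (x - y) = (x' - x) - (y' - y)); last first.
    by rewrite !opprB [y - x]addrC addrACA [- y' + y]addrC.
  rewrite (le_lt_trans (ler_normB _ _))// (le_lt_trans (lerD xx' yy'))//.
  by lra.
apply: countable_bigcupT_measurable => // -[j k].
have [h|h] := pselect (rcball j `*` rcball k `<=` (fun x => x.1 - x.2) @^-1` U).
  rewrite (_ : A _ = rcball j `*` rcball k); last first.
    by apply/seteqP; split => [[x y] [/= ? []]|[x y] [/=]].
  by apply: measurableX; exact: measurable_cball.
rewrite (_ : A _ = set0)//.
by apply/seteqP; split => [[x y] [/= ? []]|].
Qed.

Lemma measurable_fun_subrV d' (X : measurableType d') (f g : X -> V) :
  measurable_fun setT f -> measurable_fun setT g ->
  measurable_fun setT (fun x => f x - g x).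
Proof.
by move=> mf mg; exact: (measurableT_comp measurable_sub_rV (measurable_fun_pair mf mg)).
Qed.

Lemma measurable_fun_opprV d' (X : measurableType d') (f : X -> V) :
  measurable_fun setT f -> measurable_fun setT (fun x => - f x).
Proof.
move=> mf; rewrite (_ : (fun _ => _) = fun x => 0 - f x).
  exact: measurable_fun_subrV.
by apply/funext => x; rewrite sub0r.
Qed.

Lemma measurable_fun_addrV d' (X : measurableType d') (f g : X -> V) :
  measurable_fun setT f -> measurable_fun setT g ->
  measurable_fun setT (fun x => f x + g x).
Proof.
move=> mf mg; rewrite (_ : (fun _ => _) = fun x => f x - (- g x)).
  by apply: measurable_fun_subrV => //; exact: measurable_fun_opprV.
by apply/funext => x; rewrite opprK.
Qed.

Lemma bigcup_cball_natr : \bigcup_n cball 0 n%:R = setT.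
Proof.
apply/seteqP; split => // x _.
exists (Num.truncn `|x|).+1 => //=; rewrite /cball /= subr0.
by rewrite ltW// truncnS_gt.
Qed.

End balls.

Local Open Scope ereal_scope.

(** * Lebesgue measure of balls *)

Section lebesgue_balls.
Context (R : realType).

Lemma lebesgue_rV_set0 (d : nat) : lebesgue_rV (set0 : set 'rV[R]_d) = 0.
Proof.
elim: d => [|d IH] /=; first by rewrite diracE in_set0.
by rewrite (eq_integral (cst 0)) ?integral0// => t _; exact: IH.
Qed.

Let cube (d : nat) (r : R) : set 'rV[R]_d :=
  [set x | forall i, (`|x 0 i| <= r)%R].

Let lebesgue_rV_cube (d : nat) (r : R) : (0 <= r)%R ->
  lebesgue_rV (@cube d r) = ((2 * r) ^+ d)%:E.
Proof.
move=> r0; elim: d => [|d IH] /=.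
  by rewrite diracE mem_set// => -[].
transitivity (\int[@lebesgue_measure R]_t (((2 * r) ^+ d)%:E *
    (\1_`[(- r)%R, r]%classic t)%:E)).
  apply: eq_integral => t _; rewrite indicE.
  have sec x : @cube d.+1 r (row_mx (t%:M : 'rV[R]_1) x) <->
      (`|t| <= r)%R /\ @cube d r x.
    split=> [h|[ht h] i].
      split.
        by have := h (lshift d (ord0 : 'I_1)); rewrite (@row_mxEl _ 1 1 d) mxE eqxx.
      by move=> j; have := h (rshift 1 j); rewrite (@row_mxEr _ 1 1 d).
    have [j ->|j ->] := split_ordP (i : 'I_(1 + d)).
      by rewrite (@row_mxEl _ 1 1 d) mxE (ord1 j) eqxx.
    by rewrite (@row_mxEr _ 1 1 d); exact: h.
  have [tr|tr] := boolP (t \in `[(- r)%R, r]%classic).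
    rewrite mule1 -IH; congr lebesgue_rV; apply/seteqP.
    move: tr; rewrite inE /= in_itv /= -ler_norml => tr.
    by split=> x /=; [move=> /sec[]|move=> ?; apply/sec].
  rewrite mule0 -(lebesgue_rV_set0 d); congr lebesgue_rV; apply/seteqP; split => // x /=.
  by move=> /sec[tr' _]; move/negP: tr; rewrite inE /= in_itv /= -ler_norml.
rewrite ge0_integralZl//; last 2 first.
  by apply/measurable_EFinP; exact: measurable_indic.
  by rewrite lee_fin exprn_ge0// mulr_ge0.
rewrite integral_indic// setIT exprSr EFinM; congr (_ * _).
apply: etrans; first exact: (lebesgue_measure_itv `[(- r)%R, r]).
rewrite /= lte_fin; case: ltP => rr; last by congr EFin; lra.
by rewrite -EFinD; congr EFin; lra.
Qed.

Lemma lebesgue_rV_cball0 (d : nat) (r : R) : (0 <= r)%R ->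
  lebesgue_rV (cball (0 : 'rV[R]_d) r) = ((2 * r) ^+ d)%:E.
Proof.
move=> r0; rewrite -lebesgue_rV_cube//; congr lebesgue_rV; apply/seteqP.
by split=> x; rewrite /cball /cube /= subr0 => /(rV_norm_le _ r0).
Qed.

End lebesgue_balls.

(** * Translations and atoms of a configuration *)

Section config_facts.
Context (R : realType) (d : nat).
Notation V := 'rV[R]_d.
Implicit Types (pi : config R d) (y z s : V) (B C : set V).

(** Equality on all sets is required here, Borel or not. Translations satisfy
it because they are defined by preimages of arbitrary sets. *)
Lemma eq_config pi1 pi2 : (forall B, pi1 B = pi2 B) -> pi1 = pi2.
Proof.
case: pi1 pi2 => [m1 f1 i1] [m2 f2 i2] /= h.
have e : m1 = m2 by apply: eq_measure; apply/funext => B; exact: h.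
by subst m2; congr Config; exact: Prop_irrelevance.
Qed.

Lemma translateE y pi B : translate y pi B = pi [set x | B (x - y)%R].
Proof. by []. Qed.

Lemma translateD y z pi : translate y (translate z pi) = translate (z + y)%R pi.
Proof.
apply: eq_config => B; rewrite !translateE; congr (pi _).
by apply/seteqP; split => x /=; rewrite opprD addrA.
Qed.

Lemma translate0 pi : translate 0 pi = pi.
Proof.
apply: eq_config => B; rewrite !translateE; congr (pi _).
by apply/seteqP; split => x /=; rewrite subr0.
Qed.

Lemma translateK y pi : translate (- y)%R (translate y pi) = pi.
Proof. by rewrite translateD subrr translate0. Qed.

Lemma ge0_integral_translate y pi (g : V -> \bar R) :
  measurable_fun setT g -> (forall s, 0 <= g s) ->
  \int[translate y pi]_s g s = \int[pi]_s g (s - y)%R.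
Proof.
move=> mg g0.
rewrite [LHS](ge0_integral_pushforward (measurable_subr y) pi measurableT mg) //.
Qed.

Lemma measurable_set1_rV y : measurable [set y].
Proof.
have -> : [set y] = \bigcap_n cball y n.+1%:R^-1.
  apply/seteqP; split => [_ -> n _|x h]; first by rewrite /cball /= subrr normr0.
  apply/eqP; rewrite -subr_eq0 -normr_le0; apply/ler_addgt0Pr => e e0.
  have [m _ hm] := near_infty_natSinv_lt (PosNum e0).
  by rewrite add0r (le_trans (h m _))// ltW//; exact: hm (leqnn m).
by apply: bigcapT_measurable => n; exact: measurable_cball.
Qed.

Lemma config_ge1 pi B : measurable B -> pi B != 0 -> 1 <= pi B.
Proof.
move=> mB; have [->|[n ->]] := config_integer_valued pi mB; first by rewrite leey.
by rewrite eqe lee_fin pnatr_eq0 -lt0n => h; rewrite ler1n.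
Qed.

Lemma config_cball_lty pi z r : pi (cball z r) < +oo.
Proof.
by apply: config_locally_finite; [exact: measurable_cball|exact: bounded_cball].
Qed.

(** A point of a configuration is isolated: in small balls around [s] there is
no mass besides that of [s], as this mass is an integer decreasing to 0. *)
Lemma config_isolated pi s :
  exists2 e : R, (0 < e)%R & pi (cball s e) = pi [set s].
Proof.
pose F n := cball s n.+1%:R^-1 `\` [set s].
have mF n : measurable (F n).
  by apply: measurableD; [exact: measurable_cball|exact: measurable_set1_rV].
have F0 : \bigcap_n F n = set0.
  apply/seteqP; split => // x h; have [_] := h 0%N I; apply.
  apply/eqP; rewrite -subr_eq0 -normr_le0; apply/ler_addgt0Pr => e e0.
  have [m _ hm] := near_infty_natSinv_lt (PosNum e0).
  have [+ _] := h m I; rewrite add0r => /le_trans; apply.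
  by rewrite ltW//; exact: hm (leqnn m).
have : pi \o F @ \oo --> pi (\bigcap_n F n).
  apply: nonincreasing_cvg_mu => //.
  - apply: le_lt_trans (config_cball_lty pi s 1%:R^-1).
    apply: le_measure; rewrite ?inE//; last by move=> x [].
    exact: measurable_cball.
  - by rewrite F0.
  - move=> m n mn; apply/subsetPset => x [h1 h2]; split => //.
    apply: le_trans h1 _.
    by rewrite lef_pV2 ?posrE// ler_nat.
rewrite F0 measure0 => cv.
have [n hn] : exists n, pi (F n) < 1.
  have : \forall n \near \oo, (pi \o F) n < 1.
    apply: (cv [set x | x < 1]); apply: open_nbhs_nbhs; split => //=.
    exact: open_ereal_lt_ereal.
  by case=> n _ hn; exists n; exact: hn (leqnn n).
exists (n.+1%:R^-1)%R; first by rewrite invr_gt0.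
have Fn0 : pi (F n) = 0.
  by apply/eqP; apply: contraLR hn => /(config_ge1 (mF n)); rewrite -leNgt.
rewrite (_ : cball _ _ = F n `|` [set s]); last first.
  apply/seteqP; split => x.
    by move=> h; have [->|xs] := pselect (x = s); [right|left].
  by case=> [[]//|->]; rewrite /cball /= subrr normr0.
rewrite measureU//.
- by rewrite [X in X + _ = _]Fn0 add0e.
- exact: measurable_set1_rV.
- by apply/seteqP; split => // x [[_]].
Qed.

(** A location without mass has a null neighbourhood [rcball k]; so the set of
these locations is measurable and, as a countable union of null sets, null. *)
Lemma nonatoms_bigcup pi : [set s | pi [set s] = 0] =
  \bigcup_(k in [set k | pi (rcball k) = 0]) rcball k.
Proof.
apply/seteqP; split => [s /= s0|s [k /= k0 ks]].
  have [e e0 es] := config_isolated pi s.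
  have [k [ks sk _]] := rcball_small s e0.
  exists k => //=; apply: (subset_measure0 _ _ sk).
  - exact: measurable_cball.
  - exact: measurable_cball.
  - by rewrite -s0.
apply: (subset_measure0 _ _ _ k0).
- exact: measurable_set1_rV.
- exact: measurable_cball.
- by move=> _ ->.
Qed.

Lemma measurable_nonatoms pi : measurable [set s | pi [set s] = 0].
Proof.
rewrite nonatoms_bigcup; apply: bigcup_measurable => k _; exact: measurable_cball.
Qed.

Lemma config_nonatoms pi : pi [set s | pi [set s] = 0] = 0.
Proof.
rewrite nonatoms_bigcup bigcup_mkcond.
suff : pi.-negligible (\bigcup_k
    (if k \in [set k | pi (rcball k) = 0] then rcball k else set0)).
  by move=> /negligibleP; apply; rewrite -bigcup_mkcond -nonatoms_bigcup;
     exact: measurable_nonatoms.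
apply: negligible_bigcup => k; case: ifPn => [|_]; last exact: negligible_set0.
by rewrite inE /= => k0; apply/negligibleP => //; exact: measurable_cball.
Qed.

(** A configuration with mass 1 on [C] has exactly one point in [C]. *)
Lemma config1P pi C : measurable C -> pi C = 1 ->
  exists y, [/\ C y, pi [set y] = 1 & pi (C `\ y) = 0].
Proof.
move=> mC C1.
have [y [Cy y0]] : exists y, C y /\ pi [set y] != 0.
  apply: contrapT => h; have : pi C = 0.
    apply: (subset_measure0 _ _ _ (config_nonatoms pi)) => //.
      exact: measurable_nonatoms.
    by move=> y Cy; apply: contrapT => /eqP y0; apply: h; exists y.
  by rewrite C1 => /eqP; rewrite onee_eq0.
have y1 : pi [set y] = 1.
  apply/eqP; rewrite eq_le -{1}C1 config_ge1 ?andbT//; last exact: measurable_set1_rV.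
  apply: le_measure; rewrite ?inE//; last by move=> _ ->.
  exact: measurable_set1_rV.
exists y; split => //.
rewrite measureD//.
- rewrite (_ : C `&` [set y] = [set y]); last by apply/seteqP; split=> [x []|x ->].
  by rewrite [X in X - _]C1 [X in _ - X]y1 subee.
- exact: measurable_set1_rV.
- by rewrite [ltLHS]C1 ltry.
Qed.

(** If [y] carries all the mass of [C], integrating over [C] is evaluating at
[y]. *)
Lemma ge0_integral_config1 pi C y (g : V -> \bar R) : measurable C ->
  measurable_fun setT g -> (forall s, 0 <= g s) ->
  C y -> pi [set y] = 1 -> pi (C `\ y) = 0 -> \int[pi]_(s in C) g s = g y.
Proof.
move=> mC mg g0 Cy y1 C0.
have my := measurable_set1_rV y.
rewrite (ge0_negligible_integral (measurableD mC my) mC _ _ C0)//; last first.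
  exact: measurable_funTS.
rewrite (_ : C `\` (C `\ y) = [set y]); last first.
  apply/seteqP; split => [x [Cx h]|_ ->]; last by split => // -[_]; apply.
  by apply: contrapT => xy; apply: h.
rewrite (eq_integral (cst (g y))) ?integral_cst ?y1 ?mule1// => x.
by rewrite inE => ->.
Qed.

Lemma config1_setI pi C y B : measurable C -> measurable B ->
  C y -> pi [set y] = 1 -> pi (C `\ y) = 0 -> (pi (B `&` C) = 1) <-> B y.
Proof.
move=> mC mB Cy y1 C0; split=> [h|By].
  apply: contrapT => nBy.
  have : pi (B `&` C) = 0.
    apply: (subset_measure0 _ _ _ C0); first exact: measurableI.
      by apply: measurableD => //; exact: measurable_set1_rV.
    by move=> x [Bx Cx]; split => // xy; apply: nBy; rewrite -xy.
  by rewrite h => /eqP; rewrite onee_eq0.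
rewrite -integral_indic// (@ge0_integral_config1 _ _ y)//.
  by rewrite indicE mem_set.
by apply/measurable_EFinP; exact: measurable_indic.
Qed.

End config_facts.

(** * Measurability on the space of configurations *)

Section measurability_config.
Context (R : realType) (d : nat).
Notation V := 'rV[R]_d.

Lemma measurable_config_eval (B : set V) : measurable B ->
  measurable_fun setT (fun pi : config R d => pi B).
Proof.
move=> mB _ Y mY; apply: sub_sigma_algebra.
by exists B => //; exists Y.
Qed.

Lemma measurable_to_config d' (X : measurableType d') (q : X -> config R d) :
  (forall B : set V, measurable B -> measurable_fun setT (fun x => q x B)) ->
  measurable_fun setT q.
Proof.
move=> h; apply: (measurability (@config_events R d)) => //.
move=> _ [_ [B mB [Y mY <-]] <-]; rewrite setTI setTI.
by have := h B mB measurableT Y mY; rewrite setTI.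
Qed.

Section xsection.
Context d' (X : measurableType d') (q : X -> config R d).
Hypothesis mq : measurable_fun setT q.

Let k : X -> {measure set V -> \bar R} := fun x => q x.

Let mk (U : set V) : measurable U -> measurable_fun setT (k ^~ U).
Proof. by move=> mU; exact: (measurableT_comp (measurable_config_eval mU) mq). Qed.

HB.instance Definition _ := isKernel.Build _ _ _ _ _ k mk.

(** A measurable family of configurations is a kernel without uniform bounds;
local finiteness gives the claim on each ball [D n], and the balls exhaust the
space. *)
Lemma measurable_config_xsection (A : set (X * V)) : measurable A ->
  measurable_fun setT (fun x => q x (xsection A x)).
Proof.
move=> mA.
pose D n : set V := cball 0 n%:R.
have mD n : measurable (D n) by exact: measurable_cball.
apply: (emeasurable_fun_cvg (fun n x => mrestr (k x) (mD n) (xsection A x))).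
  move=> n.
  have h x : exists M, forall Y : set V, measurable Y -> mrestr (k x) (mD n) Y < M%:E.
    have kf : k x (D n) < +oo by exact: config_cball_lty.
    exists (fine (k x (D n)) + 1)%R => Y mY.
    rewrite EFinD fineK ?ge0_fin_numE//.
    apply: (@le_lt_trans _ _ (k x (D n))).
      by apply: le_measure; rewrite ?inE//; exact: measurableI.
    by rewrite lteDl ?ge0_fin_numE// lte01.
  exact: (measurable_prod_subset_xsection_kernel h mA).2.
move=> x _.
have -> : q x (xsection A x) = k x (\bigcup_n (xsection A x `&` D n)).
  by rewrite -setI_bigcupr bigcup_cball_natr setIT.
apply: nondecreasing_cvg_mu.
- by move=> n; apply: measurableI => //; exact: measurable_xsection.
- apply: bigcupT_measurable => n; apply: measurableI => //; exact: measurable_xsection.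
- move=> m n mn; apply/subsetPset => v [? h]; split => //.
  by apply: le_trans h _; rewrite ler_nat.
Qed.

Import HBNNSimple.

Lemma measurable_config_integral (g : X * V -> \bar R) :
  (forall z, 0 <= g z) -> measurable_fun setT g ->
  measurable_fun setT (fun x => \int[q x]_s g (x, s)).
Proof.
move=> g0 mg.
pose g_ := nnsfun_approx measurableT mg.
apply: (@measurable_fun_xsection_integral _ _ _ _ _ g k g_).
- by move=> a b ab; exact/nd_nnsfun_approx.
- by move=> z; exact/cvg_nnsfun_approx.
- by move=> n r; exact: measurable_config_xsection.
Qed.

End xsection.

(** Joint measurability of the action of R^d on configurations. *)
Lemma measurable_translate :
  measurable_fun setT (fun xp : V * config R d => translate xp.1 xp.2).
Proof.
apply: measurable_to_config => B mB.
pose A := (fun t : (V * config R d) * V => t.2 - t.1.1)%R @^-1` B.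
have mA : measurable A.
  rewrite -[A]setTI; apply: (_ : measurable_fun setT _) => //.
  apply: measurable_fun_subrV; first exact: measurable_snd.
  by apply: (measurableT_comp measurable_fst); exact: measurable_fst.
have := measurable_config_xsection
  (measurable_snd : measurable_fun setT (@snd V (config R d))) mA.
congr (measurable_fun _ _); apply/funext => -[x p] /=; rewrite translateE.
by congr (p _); apply/seteqP; split => s; rewrite /xsection /A /= inE.
Qed.

Lemma measurable_translate_fun d' (X : measurableType d')
    (y : X -> V) (q : X -> config R d) :
  measurable_fun setT y -> measurable_fun setT q ->
  measurable_fun setT (fun x => translate (y x) (q x)).
Proof.
move=> my mq.
exact: (measurableT_comp measurable_translate (measurable_fun_pair my mq)).
Qed.

Lemma measurable_config_integral_translate (f : config R d -> \bar R) (B : set V) :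
  measurable_fun setT f -> (forall p, 0 <= f p) -> measurable B ->
  measurable_fun setT
    (fun p : config R d => \int[p]_(s in B) f (translate s p)).
Proof.
move=> mf f0 mB.
have := @measurable_config_integral _ _ _ (@measurable_id _ (config R d) setT)
  (fun z => (\1_B z.2)%:E * f (translate z.2 z.1)).
rewrite (_ : (fun p : config R d => _) =
    fun p : config R d => \int[p]_s ((\1_B s)%:E * f (translate s p))); last first.
  apply/funext => p; rewrite integral_mkcond; apply: eq_integral => s _.
  by rewrite patchE indicE; case: ifPn => _; rewrite ?mul1e ?mul0e.
apply.
  by move=> z; rewrite mule_ge0// lee_fin.
apply: emeasurable_funM.
  apply/measurable_EFinP.
  exact: (measurableT_comp (measurable_indic mB) measurable_snd).
apply: (measurableT_comp mf); apply: measurable_translate_fun.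
  exact: measurable_snd.
exact: measurable_fst.
Qed.

End measurability_config.

(** * The greedy allocation *)

Section greedy_allocation.
Context (R : realType) (d : nat).
Notation V := 'rV[R]_d.
Notation M := (config R d).
Variable lam : {sigma_finite_measure set V -> \bar R}.
Implicit Types (pi : M) (u s y : V) (U S : set M) (v : M -> \bar R).

(** The sites [u] that see the origin inside [rcball k], and from which the
configuration [pi] is in the event [S]. When [S] says that the origin proposes
(or is accepted) at stage [k], this is the set of sites which propose to (or
are accepted by) a point of [pi] at the origin. *)
Definition region (k : nat) S pi : set V :=
  [set u | rcball k (- u)%R /\ S (translate u pi)].

(** In the next three definitions [U] is the event that the origin has been
assigned before stage [k], and [v pi] the volume of sites assigned before to a
point of [pi] at the origin. The origin proposes at stage [k] if it is
unassigned and the configuration has one point in [rcball k]. *)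
Definition proposers (k : nat) U : set M :=
  [set pi : M | pi (rcball k) = 1 /\ ~ U pi].

(** A point at the origin accepts if its total volume remains at most 1. *)
Definition accepting (k : nat) U v : set M :=
  [set pi : M | v pi + lam (region k (proposers k U) pi) <= 1].

(** The origin is assigned at stage [k] if it proposes and if the only point in
[rcball k] accepts. The location of this point is not needed: the second
condition says that the accepting points carry the mass 1 of [rcball k]. *)
Definition stage (k : nat) U v : set M :=
  [set pi : M | proposers k U pi /\
    pi ([set s | accepting k U v (translate s pi)] `&` rcball k) = 1].

(** The pair ([U], [v]) before stage [k]. *)
Fixpoint greedy (k : nat) : set M * (M -> \bar R) :=
  if k is j.+1 then
    let: (U, v) := greedy j in
    (U `|` stage j U v, fun pi => v pi + lam (region j (stage j U v) pi))
  else (set0, cst 0).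

(** The event that the origin is assigned before stage [k], and the volume
assigned before stage [k] to a point at the origin. *)
Definition assigned k := (greedy k).1.
Definition filled k := (greedy k).2.

(** The event that the origin is assigned at stage [k]. *)
Definition newly k := stage k (assigned k) (filled k).

(** Volume of the sites that are ever assigned to a point at the origin. *)
Definition load pi : \bar R := \sum_(k <oo) lam (region k (newly k) pi).

Lemma assignedS k : assigned k.+1 = assigned k `|` newly k.
Proof. by rewrite /newly /assigned /filled /=; case: (greedy k). Qed.

Lemma filledS k pi : filled k.+1 pi = filled k pi + lam (region k (newly k) pi).
Proof. by rewrite /newly /assigned /filled /=; case: (greedy k). Qed.

Lemma filledE k pi : filled k pi = \sum_(0 <= j < k) lam (region j (newly j) pi).
Proof.
elim: k => [|k IH]; first by rewrite big_geq.
by rewrite filledS IH big_nat_recr.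
Qed.

Lemma filled_ge0 k pi : 0 <= filled k pi.
Proof. by rewrite filledE sume_ge0. Qed.

Lemma filled_le_load k pi : filled k pi <= load pi.
Proof. by rewrite filledE; exact: nneseries_lim_ge. Qed.

Lemma load_ge0 pi : 0 <= load pi.
Proof. exact: (le_trans (filled_ge0 0 pi) (filled_le_load 0 pi)). Qed.

Lemma assignedP k pi : assigned k pi <-> exists2 j, (j < k)%N & newly j pi.
Proof.
elim: k => [|k IH]; first by split => // -[].
rewrite assignedS; split => [[/IH[j jk h]|h]|[j]].
- by exists j => //; rewrite ltnS ltnW.
- by exists k.
rewrite ltnS leq_eqVlt => /orP[/eqP-> h|jk h]; first by right.
by left; apply/IH; exists j.
Qed.

Lemma newly_rcball k pi : newly k pi -> pi (rcball k) = 1.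
Proof. by case=> -[]. Qed.

Lemma newly_uniq j k pi : newly j pi -> newly k pi -> j = k.
Proof.
wlog jk : j k / (j <= k)%N.
  by move=> h hj hk; case/orP: (leq_total j k) => ?; [exact: h|symmetry; exact: h].
move=> hj [[_ nk] _]; apply/eqP; apply: contrapT => /negP jnk; apply: nk.
by apply/assignedP; exists j => //; rewrite ltn_neqAle jnk.
Qed.

Lemma measurable_region_set S k : measurable S ->
  measurable [set z : M * V | region k S z.1 z.2].
Proof.
move=> mS.
rewrite (_ : [set z | _] = ((fun z : M * V => - z.2)%R @^-1` (rcball k)) `&`
   ((fun z : M * V => translate z.2 z.1) @^-1` S)) //.
apply: measurableI.
  rewrite -[X in measurable X]setTI; apply: (_ : measurable_fun setT _) => //.
    by apply: measurable_fun_opprV; exact: measurable_snd.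
  exact: measurable_cball.
rewrite -[X in measurable X]setTI; apply: (_ : measurable_fun setT _) => //.
by apply: measurable_translate_fun; [exact: measurable_snd|exact: measurable_fst].
Qed.

Lemma measurable_region S k pi : measurable S -> measurable (region k S pi).
Proof.
move=> mS; have := measurable_xsection pi (measurable_region_set k mS).
by congr measurable; apply/seteqP; split => u; rewrite /xsection /= inE.
Qed.

Lemma measurable_lam_region S k : measurable S ->
  measurable_fun setT (fun pi => lam (region k S pi)).
Proof.
move=> mS; have := measurable_fun_xsection lam (measurable_region_set k mS).
congr (measurable_fun _ _); apply/funext => pi /=; congr (lam _).
by apply/seteqP; split => u; rewrite /xsection /= inE.
Qed.

Lemma measurable_config_eq (B : set V) (c : \bar R) : measurable B ->
  measurable [set pi : M | pi B = c].
Proof.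
move=> mB; rewrite -[X in measurable X]setTI.
exact: (measurable_config_eval mB measurableT (emeasurable_set1 c)).
Qed.

Lemma measurable_config_translate (S : set M) : measurable S ->
  measurable [set z : M * V | S (translate z.2 z.1)].
Proof.
move=> mS; rewrite -[X in measurable X]setTI.
apply: (_ : measurable_fun setT (fun z : M * V => translate z.2 z.1)) => //.
by apply: measurable_translate_fun; [exact: measurable_snd|exact: measurable_fst].
Qed.

Lemma measurable_translate_set (S : set M) pi : measurable S ->
  measurable [set s | S (translate s pi)].
Proof.
move=> mS; have := measurable_xsection pi (measurable_config_translate mS).
by congr measurable; apply/seteqP; split => u; rewrite /xsection /= inE.
Qed.

Lemma measurable_config_eval_translate (S : set M) (B : set V) :
  measurable S -> measurable B ->
  measurable_fun setT (fun pi => pi ([set s | S (translate s pi)] `&` B)).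
Proof.
move=> mS mB.
have mA : measurable ([set z : M * V | S (translate z.2 z.1)] `&` (setT `*` B)).
  by apply: measurableI; [exact: measurable_config_translate|exact: measurableX].
have := measurable_config_xsection (@measurable_id _ M setT) mA.
congr (measurable_fun _ _); apply/funext => pi /=; congr (pi _).
by apply/seteqP; split => u; rewrite /xsection /= inE /= => -[? ?]; tauto.
Qed.

Lemma measurable_proposers k U : measurable U -> measurable (proposers k U).
Proof.
move=> mU; apply: measurableI; last exact: measurableC.
by apply: measurable_config_eq; exact: measurable_cball.
Qed.

Lemma measurable_accepting k U v : measurable U -> measurable_fun setT v ->
  measurable (accepting k U v).
Proof.
move=> mU mv.
have mf : measurable_fun setT
    (fun pi => v pi + lam (region k (proposers k U) pi)).
  apply: emeasurable_funD => //; apply: measurable_lam_region.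
  exact: measurable_proposers.
have := mf measurableT _ (emeasurable_itv `]-oo, 1]); rewrite setTI.
by congr measurable; apply/seteqP; split => pi; rewrite /accepting /= in_itv.
Qed.

Lemma measurable_stage k U v : measurable U -> measurable_fun setT v ->
  measurable (stage k U v).
Proof.
move=> mU mv; apply: measurableI; first exact: measurable_proposers.
rewrite -[X in measurable X]setTI.
apply: (measurable_config_eval_translate (measurable_accepting k mU mv)
  (@measurable_cball _ _ _ _) measurableT (emeasurable_set1 1)).
Qed.

Lemma measurable_greedy k :
  measurable (assigned k) /\ measurable_fun setT (filled k).
Proof.
elim: k => [|k [mU mv]]; first by split; [exact: measurable0|exact: measurable_cst].
rewrite assignedS; split.
  by apply: measurableU => //; exact: measurable_stage.
rewrite (_ : filled _ = fun pi => filled k pi + lam (region k (newly k) pi)).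
  apply: emeasurable_funD => //.
  by apply: measurable_lam_region; exact: measurable_stage.
by apply/funext => pi; exact: filledS.
Qed.

Lemma measurable_newly k : measurable (newly k).
Proof. by have [? ?] := measurable_greedy k; exact: measurable_stage. Qed.

Lemma measurable_load : measurable_fun setT load.
Proof.
apply: ge0_emeasurable_sum => // k _.
by apply: measurable_lam_region; exact: measurable_newly.
Qed.

Lemma translate_atom u pi : translate u pi [set (- u)%R] = pi [set 0%R].
Proof.
rewrite translateE; congr (pi _); apply/seteqP; split => x /=.
  by move=> /eqP; rewrite subr_eq addNr => /eqP.
by move=> ->; rewrite sub0r.
Qed.

(** Seen from a point [0] of [pi], the site [u] is assigned to it if and only if
[u] proposes to it and it accepts. *)
Lemma newly_atom k u pi : pi [set 0%R] = 1 -> rcball k (- u)%R ->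
  newly k (translate u pi) <->
  proposers k (assigned k) (translate u pi) /\
  accepting k (assigned k) (filled k) pi.
Proof.
move=> pi0 ku.
have [mU mv] := measurable_greedy k.
have macc := measurable_accepting k mU mv.
set p := translate u pi.
have pu : p [set (- u)%R] = 1 by rewrite translate_atom.
suff h : p (rcball k) = 1 ->
    (p ([set s | accepting k (assigned k) (filled k) (translate s p)] `&`
       rcball k) = 1) <-> accepting k (assigned k) (filled k) pi.
  by split => [[pk hk]|[pk hk]]; split => //; have [hk1 _] := pk; apply/(h hk1).
move=> hk.
have mk : measurable (rcball k : set V) by exact: measurable_cball.
have pku : p (rcball k `\ (- u)%R) = 0.
  have [y [ky y1 y0]] := config1P mk hk.
  suff -> : (- u)%R = y by [].
  apply: contrapT => uy; have : p [set (- u)%R] = 0.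
    apply: (subset_measure0 _ _ _ y0); first exact: measurable_set1_rV.
      by apply: measurableD => //; exact: measurable_set1_rV.
    by move=> _ ->; split.
  by rewrite pu => /eqP; rewrite onee_eq0.
have := config1_setI mk (measurable_translate_set p macc) ku pu pku.
by rewrite /= translateK.
Qed.

Lemma filled_le1 k pi : pi [set 0%R] = 1 -> filled k pi <= 1.
Proof.
move=> pi0; elim: k => [|k IH]; first by rewrite filledE big_geq.
rewrite filledS.
have [acc|nacc] := pselect (accepting k (assigned k) (filled k) pi).
  apply: le_trans acc; apply: leeD2l; rewrite le_measure ?inE//.
  - by apply: measurable_region; exact: measurable_newly.
  - apply: measurable_region; apply: measurable_proposers.
    exact: (measurable_greedy k).1.
  - by move=> u [ku nu]; split => //; have [] := (newly_atom pi0 ku).1 nu.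
rewrite (_ : region _ _ _ = set0) ?measure0 ?adde0//.
by apply/seteqP; split => // u [ku /(newly_atom pi0 ku)[]].
Qed.

Lemma load_le1 pi : pi [set 0%R] = 1 -> load pi <= 1.
Proof.
move=> pi0; apply: lime_le; first exact: is_cvg_nneseries.
by apply: nearW => k; rewrite -filledE; exact: filled_le1.
Qed.

(** Small balls have small volume, uniformly in their centre. *)
Hypothesis lam_small : forall e : R, (0 < e)%R -> exists2 r0 : R, (0 < r0)%R &
  forall (z : V) (r : R), (r <= r0)%R -> lam (cball z r) <= e%:E.

(** If a point of mass 1 at the origin has a volume less than 1, then every site
is assigned: there is a ball [rcball k] around [- u] that is so small that it
isolates this point as seen from [u], and that the volume of the proposals made
to the point at stage [k] is below the volume it lacks. *)
Lemma unfilled_assigned pi : pi [set 0%R] = 1 -> load pi < 1 ->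
  forall u, exists k, newly k (translate u pi).
Proof.
move=> pi0 lpi u; set p := translate u pi.
have lfin : load pi \is a fin_num.
  by rewrite ge0_fin_numE ?load_ge0// (lt_le_trans lpi)// leey.
have e0 : (0 < 1 - fine (load pi))%R.
  by rewrite subr_gt0 -lte_fin fineK.
have [r0 r00 hr0] := lam_small e0.
have [e1 e10 pe1] := config_isolated p (- u)%R.
have pu : p [set (- u)%R] = 1 by rewrite translate_atom.
have m0 : (0 < Num.min r0 e1)%R by rewrite lt_min r00.
have [k [ku sk rk]] := rcball_small (- u)%R m0.
have mk : measurable (rcball k : set V) by exact: measurable_cball.
have pk : p (rcball k) = 1.
  apply/eqP; rewrite eq_le; apply/andP; split.
    rewrite -pu -pe1; apply: le_measure; rewrite ?inE//; first exact: measurable_cball.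
    move=> x /sk; rewrite /cball /= => h; apply: (le_trans h).
    by rewrite ge_min lexx orbT.
  rewrite -pu; apply: le_measure; rewrite ?inE//; first exact: measurable_set1_rV.
  by move=> _ ->.
have [/assignedP[j _ hj]|nak] := pselect (assigned k p); first by exists j.
exists k; apply/(newly_atom pi0 ku); split => //.
rewrite /accepting /= (_ : 1 = load pi + (1 - fine (load pi))%:E); last first.
  by rewrite -{1}(fineK lfin) -EFinD; congr EFin; lra.
apply: leeD; first exact: filled_le_load.
have h : lam (region k (proposers k (assigned k)) pi) <=
    lam (cball (- ball_center R d k)%R (ball_radius R d k)).
  apply: le_measure; rewrite ?inE.
  - apply: measurable_region; apply: measurable_proposers.
    exact: (measurable_greedy k).1.
  - exact: measurable_cball.
  - move=> w [+ _]; rewrite /rcball /cball /= => h.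
    by rewrite opprK -normrN opprD.
apply: (le_trans h).
by apply: hr0; apply: (le_trans rk); rewrite ge_min lexx.
Qed.

End greedy_allocation.

(** * The point allocated to the origin *)

Section head_point.
Context (R : realType) (d : nat).
Notation V := 'rV[R]_d.
Notation M := (config R d).
Variable lam : {sigma_finite_measure set V -> \bar R}.
Implicit Types (pi : M).

(** The point to which the origin is assigned, and 0 if the origin is never
assigned. *)
Definition head pi : V := xget 0%R
  [set y | exists k, [/\ newly lam k pi, rcball k y & pi [set y] = 1]].

Lemma headP k pi : newly lam k pi ->
  [/\ rcball k (head pi), pi [set head pi] = 1 & pi (rcball k `\ head pi) = 0].
Proof.
move=> hk; have mk : measurable (rcball k : set V) by exact: measurable_cball.
have [y [ky y1 y0]] := config1P mk (newly_rcball hk).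
have ey : exists y, exists k, [/\ newly lam k pi, rcball k y & pi [set y] = 1].
  by exists y, k.
have [j [hj]] := xgetPex 0%R ey; rewrite -/(head pi) (newly_uniq hj hk) => jh h1.
suff -> : head pi = y by [].
apply: contrapT => hy; have : pi [set head pi] = 0.
  apply: (subset_measure0 _ _ _ y0); first exact: measurable_set1_rV.
    by apply: measurableD => //; exact: measurable_set1_rV.
  by move=> _ ->; split.
by rewrite h1 => /eqP; rewrite onee_eq0.
Qed.

Lemma head_unassigned pi : (forall k, ~ newly lam k pi) -> head pi = 0%R.
Proof.
by move=> h; rewrite /head xgetPN// => y [k [/h]].
Qed.

Lemma measurable_head : measurable_fun setT head.
Proof.
move=> _ B mB; rewrite setTI.
have mk k : measurable (rcball k : set V) by exact: measurable_cball.
rewrite (_ : head @^-1` B =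
    \bigcup_k (newly lam k `&` [set pi : M | pi (B `&` rcball k) = 1]) `|`
    (~` (\bigcup_k newly lam k) `&` [set pi : M | B 0%R])).
  apply: measurableU.
    apply: bigcupT_measurable => k; apply: measurableI; first exact: measurable_newly.
    by apply: measurable_config_eq; exact: measurableI.
  apply: measurableI.
    by apply: measurableC; apply: bigcupT_measurable => k; exact: measurable_newly.
  have [B0|B0] := pselect (B 0%R).
    by rewrite (_ : [set _ | _] = setT)//; apply/seteqP; split.
  by rewrite (_ : [set _ | _] = set0)//; apply/seteqP; split.
apply/seteqP; split => pi /=.
  move=> Bh; have [[k hk]|nk] := pselect (exists k, newly lam k pi).
    left; exists k => //; split => //=; have [kh h1 h0] := headP hk.
    exact/(config1_setI (mk k) mB kh h1 h0).
  right; split; first by move=> [k _ hk]; apply: nk; exists k.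
  by rewrite /= -(@head_unassigned pi)// => k hk; apply: nk; exists k.
case=> [[k _ [hk]]|[nk B0]].
  by have [kh h1 h0] := headP hk; move/(config1_setI (mk k) mB kh h1 h0).
by rewrite head_unassigned// => k hk; apply: nk; exists k.
Qed.

End head_point.

(** * Mass transport *)

Section mass_transport.
Context (R : realType) (d : nat).
Notation V := 'rV[R]_d.
Notation M := (config R d).
Variable lam : {sigma_finite_measure set V -> \bar R}.
Variable nu : probability M R.
Hypothesis lamT : forall (y : V) (B : set V), measurable B ->
  lam [set x | B (x - y)%R] = lam B.
Hypothesis nuT : forall (y : V) (A : set M), measurable A ->
  nu [set p | A (translate y p)] = nu A.

Lemma config_sigma_finite (p : M) : sigma_finite setT p.
Proof.
exists (fun n => cball 0%R n%:R); first by rewrite bigcup_cball_natr.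
by move=> n; split; [exact: measurable_cball|exact: config_cball_lty].
Qed.

(** A configuration, as a sigma-finite measure. *)
Definition config_sf (p : M) : {sigma_finite_measure set V -> \bar R} :=
  HB.pack (p : set V -> \bar R) (Measure.class (config_measure p))
    (isSFinite.Build _ _ _ (p : set V -> \bar R)
      (sfinite_measure_sigma_finite (config_sigma_finite p)))
    (isSigmaFinite.Build _ _ _ (p : set V -> \bar R) (config_sigma_finite p)).

Lemma ge0_integral_lamT (y : V) (h : V -> \bar R) : measurable_fun setT h ->
  (forall x, 0 <= h x) -> \int[lam]_x h (x - y)%R = \int[lam]_x h x.
Proof.
move=> mh h0.
transitivity (\int[pushforward lam (fun x => x - y)%R]_x h x).
  by rewrite (ge0_integral_pushforward (measurable_subr y) lam measurableT mh).
apply: eq_measure_integral => [|mf B mB _]; first exact: measurable_subr.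
exact: (lamT y mB).
Qed.

Lemma ge0_integral_nuT (y : V) (h : M -> \bar R) : measurable_fun setT h ->
  (forall x, 0 <= h x) -> \int[nu]_p h (translate y p) = \int[nu]_p h p.
Proof.
move=> mh h0.
have my : measurable_fun setT (fun p : M => translate y p).
  by apply: measurable_translate_fun; [exact: measurable_cst|exact: measurable_id].
transitivity (\int[pushforward nu (fun p => translate y p)]_x h x).
  by rewrite (ge0_integral_pushforward my nu measurableT mh).
by apply: eq_measure_integral => B mB _; exact: (nuT y mB).
Qed.

Lemma fubini_curry d1 d2 (T1 : measurableType d1) (T2 : measurableType d2)
    (m1 : {sigma_finite_measure set T1 -> \bar R})
    (m2 : {sigma_finite_measure set T2 -> \bar R}) (f : T1 -> T2 -> \bar R) :
  measurable_fun setT (fun z => f z.1 z.2) -> (forall x y, 0 <= f x y) ->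
  \int[m1]_x \int[m2]_y f x y = \int[m2]_y \int[m1]_x f x y.
Proof.
by move=> mf f0; exact: (fubini_tonelli (fun z => f z.1 z.2) mf (fun z => f0 z.1 z.2)).
Qed.

Lemma fubini_config d1 (T1 : measurableType d1)
    (m1 : {sigma_finite_measure set T1 -> \bar R}) (p : M) (f : T1 -> V -> \bar R) :
  measurable_fun setT (fun z => f z.1 z.2) -> (forall x y, 0 <= f x y) ->
  \int[m1]_x \int[p]_y f x y = \int[p]_y \int[m1]_x f x y.
Proof. exact: (@fubini_curry _ _ _ _ m1 (config_sf p)). Qed.

(** Measurability of maps to R^d and to configurations that are built from
projections by vector operations and translations. *)
Ltac mvec := first [ assumption
  | exact: measurable_id | exact: measurable_cst | exact: measurable_fst
  | exact: measurable_snd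
  | apply: measurable_translate_fun; mvec
  | apply: measurable_fun_subrV; mvec
  | apply: measurable_fun_addrV; mvec
  | apply: measurable_fun_opprV; mvec
  | apply: measurable_fun_pair; mvec
  | apply: (measurableT_comp measurable_fst); mvec
  | apply: (measurableT_comp measurable_snd); mvec ].

(** Mass transport principle. Let [g (s, p)] be the mass sent from the origin to
[s] when the configuration is [p]; equivariance defines the mass sent from any
site [x]. The expected mass sent from [B] to the points of the process equals
the expected mass received by the points of the process lying in [B]. *)
Lemma mass_transport (g : V * M -> \bar R) (B : set V) :
  measurable_fun setT g -> (forall z, 0 <= g z) -> measurable B ->
  lam B * \int[nu]_p \int[p]_s g (s, p) =
  \int[nu]_p \int[p]_(s in B)
    \int[lam]_u g (- u, translate u (translate s p))%R.
Proof.
move=> mg g0 mB.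
pose iB (x : V) : \bar R := (\1_B x)%:E.
have iB0 x : 0 <= iB x by rewrite lee_fin.
have miB : measurable_fun setT iB.
  by apply/measurable_EFinP; exact: measurable_indic.
have mgX d' (X : measurableType d') (a : X -> V) (q : X -> M) :
    measurable_fun setT a -> measurable_fun setT q ->
    measurable_fun setT (fun x => g (a x, q x)).
  by move=> ma mq; exact: (measurableT_comp mg (measurable_fun_pair ma mq)).
have miX d' (X : measurableType d') (a : X -> V) (f : X -> \bar R) :
    measurable_fun setT a -> measurable_fun setT f ->
    measurable_fun setT (fun x => iB (a x) * f x).
  by move=> ma mf; apply: emeasurable_funM => //; exact: (measurableT_comp miB ma).
pose h (p : M) := \int[p]_s g (s, p).
have h0 p : 0 <= h p by exact: integral_ge0.
have mh : measurable_fun setT h.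
  apply: (measurable_config_integral (@measurable_id _ M setT)
    (g := fun z => g (z.2, z.1))) => //.
  by apply: mgX; mvec.
pose G (u s : V) (p : M) := g (- u, translate u (translate s p))%R.
have G0 u s p : 0 <= G u s p by exact: g0.
have mG d' (X : measurableType d') (u s : X -> V) (q : X -> M) :
    measurable_fun setT u -> measurable_fun setT s -> measurable_fun setT q ->
    measurable_fun setT (fun x => G (u x) (s x) (q x)).
  by move=> mu ms mq; apply: mgX; mvec.
transitivity (\int[lam]_x \int[nu]_p (iB x * h (translate x p))).
  transitivity (\int[lam]_x (iB x * \int[nu]_p h p)).
    rewrite ge0_integralZr//; last exact: integral_ge0.
    by rewrite integral_indic ?setIT.
  apply: eq_integral => x _; rewrite -(ge0_integral_nuT x)// ge0_integralZl//.
  by apply: (measurableT_comp mh); mvec.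
rewrite fubini_curry; last 2 first.
- apply: miX; first by mvec.
  by apply: (measurableT_comp mh); mvec.
- by move=> x p; rewrite mule_ge0.
transitivity (\int[nu]_p \int[lam]_u \int[p]_s (iB (u + s)%R * G u s p)).
  apply: eq_integral => p _.
  transitivity (\int[lam]_x \int[p]_s (iB x * g (s - x, translate x p)%R)).
    apply: eq_integral => x _; rewrite ge0_integralZl//.
      rewrite /h (@ge0_integral_translate _ _ _ _ (fun s => g (s, translate x p)))//.
      by apply: mgX; mvec.
    by apply: mgX; mvec.
  rewrite fubini_config; last 2 first.
  - apply: miX; first by mvec.
    by apply: mgX; mvec.
  - by move=> x s; rewrite mule_ge0.
  rewrite [RHS]fubini_config; last 2 first.
  - apply: miX; first by mvec.
    by apply: mG; mvec.
  - by move=> x s; rewrite mule_ge0.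
  apply: eq_integral => s _.
  (* change of variable x = u + s *)
  rewrite -(@ge0_integral_lamT (- s)%R); last 2 first.
  - apply: miX; first by mvec.
    by apply: mgX; mvec.
  - by move=> x; rewrite mule_ge0.
  apply: eq_integral => u _; rewrite opprK /G translateD; congr (_ * g (_, _)).
    by rewrite opprD addrCA subrr addr0.
  by rewrite addrC.
rewrite fubini_curry; last 2 first.
- apply: (measurable_config_integral (measurable_fst : measurable_fun setT (@fst M V))
    (g := fun z => iB (z.1.2 + z.2)%R * G z.1.2 z.2 z.1.1)).
    by move=> z; rewrite mule_ge0.
  apply: miX; first by mvec.
  by apply: mG; mvec.
- by move=> p u; apply: integral_ge0 => s _; rewrite mule_ge0.
have mF4 : measurable_fun setT
    (fun z : M * V => \int[z.1]_s (iB s * G z.2 s z.1)).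
  apply: (measurable_config_integral (measurable_fst : measurable_fun setT (@fst M V))
    (g := fun z => iB z.2 * G z.1.2 z.2 z.1.1)).
    by move=> z; rewrite mule_ge0.
  apply: miX; first by mvec.
  by apply: mG; mvec.
transitivity (\int[lam]_u \int[nu]_p \int[p]_s (iB s * G u s p)).
  apply: eq_integral => u _.
  (* invariance of nu under the translation by -u, for each u *)
  rewrite -[RHS](ge0_integral_nuT (- u)%R); last 2 first.
  - have mu : measurable_fun setT (fun p : M => (p, u)) by mvec.
    exact: (measurableT_comp mF4 mu).
  - by move=> p; apply: integral_ge0 => s _; rewrite mule_ge0.
  apply: eq_integral => p _.
  rewrite ge0_integral_translate; last 2 first.
  - apply: miX; first by mvec.
    by apply: mG; mvec.
  - by move=> s; rewrite mule_ge0.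
  apply: eq_integral => s _; rewrite opprK /G.
  by rewrite [translate (s + u) _]translateD [(- u + _)%R]addrC addrK [(u + s)%R]addrC.
rewrite -fubini_curry; last 2 first.
- exact: mF4.
- by move=> p u; apply: integral_ge0 => s _; rewrite mule_ge0.
apply: eq_integral => p _.
rewrite fubini_config; last 2 first.
- apply: miX; first by mvec.
  by apply: mG; mvec.
- by move=> x s; rewrite mule_ge0.
rewrite [RHS]integral_mkcond; apply: eq_integral => s _.
rewrite patchE ge0_integralZl//; last by apply: mG; mvec.
rewrite /iB indicE; case: ifPn => sB; first by rewrite mul1e.
by rewrite mul0e.
Qed.

End mass_transport.

(** * Points of multiplicity one *)

Section multiplicity.
Context (R : realType) (d : nat).
Notation V := 'rV[R]_d.
Notation M := (config R d).
Implicit Types (p : M) (s : V).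

(** Locations of [p] that lie in no ball [rcball k] of mass 1. Up to locations
without mass, these are the points of multiplicity at least 2; this form makes
the dependence on [p] measurable. *)
Definition multiple p : set V :=
  [set s | forall k, rcball k s -> p (rcball k) <> 1].

Lemma measurable_multiple_set :
  measurable [set z : M * V | multiple z.1 z.2].
Proof.
rewrite (_ : [set _ | _] = ~` \bigcup_k
    ([set p : M | p (rcball k) = 1] `*` (rcball k : set V))).
  apply: measurableC; apply: bigcupT_measurable => k; apply: measurableX.
    by apply: measurable_config_eq; exact: measurable_cball.
  exact: measurable_cball.
apply/seteqP; split => [[p s] /= h [k _ [/= pk ks]]|[p s] /= h k ks pk].
  exact: (h k).
by apply: h; exists k.
Qed.

Lemma measurable_multiple p : measurable (multiple p).
Proof.
have := measurable_xsection p measurable_multiple_set.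
by congr measurable; apply/seteqP; split => u; rewrite /xsection /= inE.
Qed.

Lemma measurable_eval_multiple : measurable_fun setT (fun p => p (multiple p)).
Proof.
have := measurable_config_xsection (@measurable_id _ M setT) measurable_multiple_set.
congr (measurable_fun _ _); apply/funext => p /=; congr (p _).
by apply/seteqP; split => u; rewrite /xsection /= inE.
Qed.

Lemma simple_multiple p : (forall x, p [set x] != 0 -> p [set x] = 1) ->
  p (multiple p) = 0.
Proof.
move=> hp; apply: (subset_measure0 _ _ _ (config_nonatoms p)).
- exact: measurable_multiple.
- exact: measurable_nonatoms.
move=> s hs /=; apply: contrapT => /eqP /hp s1.
have [e e0 es] := config_isolated p s.
have [k [ks sk _]] := rcball_small s e0.
apply: (hs k ks); apply/eqP; rewrite eq_le; apply/andP; split.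
  by rewrite -s1 -es; apply: le_measure; rewrite ?inE//; exact: measurable_cball.
rewrite -s1; apply: le_measure; rewrite ?inE//.
- exact: measurable_set1_rV.
- exact: measurable_cball.
- by move=> _ ->.
Qed.

Lemma atom_mass1 p s : ~ multiple p s -> p [set s] <> 0 -> p [set s] = 1.
Proof.
move=> hs /eqP s0.
have [k [ks pk]] : exists k, rcball k s /\ p (rcball k) = 1.
  by apply: contrapT => h; apply: hs => k ks pk; apply: h; exists k.
apply/eqP; rewrite eq_le config_ge1 ?andbT//; last exact: measurable_set1_rV.
rewrite -pk; apply: le_measure; rewrite ?inE//.
- exact: measurable_set1_rV.
- exact: measurable_cball.
- by move=> _ ->.
Qed.

Lemma translate_set1 s p : translate s p [set 0%R] = p [set s].
Proof.
rewrite translateE; congr (p _); apply/seteqP; split => x /=.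
  by move=> /eqP; rewrite subr_eq0 => /eqP.
by move=> ->; rewrite subrr.
Qed.

(** If [p] has only points of mass 1, a set avoiding all of them is null. *)
Lemma multiple0_null p (N : set V) : measurable N -> p (multiple p) = 0 ->
  (forall s, p [set s] = 1 -> ~ N s) -> p N = 0.
Proof.
move=> mN pm hN.
have mE : measurable (multiple p `|` [set s | p [set s] = 0]).
  by apply: measurableU; [exact: measurable_multiple|exact: measurable_nonatoms].
have E0 : p (multiple p `|` [set s | p [set s] = 0]) = 0.
  apply/eqP; rewrite eq_le measure_ge0 andbT.
  rewrite (le_trans (measureU2 _ _ _))//.
  - exact: measurable_multiple.
  - exact: measurable_nonatoms.
  - by rewrite [X in X + _]pm [X in _ + X]config_nonatoms adde0.
apply: (subset_measure0 _ _ _ E0) => // s Ns.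
apply: contrapT => /not_orP[h1 h2]; exact: hN (atom_mass1 h1 h2) Ns.
Qed.

End multiplicity.

(** * Transport along the allocation *)

Section allocation_identity.
Context (R : realType) (d : nat).
Notation V := 'rV[R]_d.
Notation M := (config R d).
Variable lam : {sigma_finite_measure set V -> \bar R}.
Variable nu : probability M R.
Hypothesis lamT : forall (y : V) (B : set V), measurable B ->
  lam [set x | B (x - y)%R] = lam B.
Hypothesis nuT : forall (y : V) (A : set M), measurable A ->
  nu [set p | A (translate y p)] = nu A.

(** The event that the origin is assigned at some stage. *)
Definition everassigned : set M := \bigcup_k newly lam k.

Lemma measurable_everassigned : measurable everassigned.
Proof. by apply: bigcupT_measurable => k; exact: measurable_newly. Qed.

Lemma series_newly p :
  \sum_(k <oo) (\1_(newly lam k) p)%:E = (\1_everassigned p)%:E :> \bar R.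
Proof.
have : \d_p everassigned = \sum_(k <oo) \d_p (newly lam k) :> \bar R.
  rewrite /everassigned measure_bigcup//; last 2 first.
  - by move=> k _; exact: measurable_newly.
  - by apply/trivIsetP => i j _ _ /eqP ij; apply/seteqP; split => // q [/newly_uniq h /h].
  by apply: eq_eseriesl => k; rewrite in_setT.
by rewrite diracE indicE => ->; apply: eq_eseriesr => k _; rewrite diracE indicE.
Qed.

(** Mass transport for [f] evaluated at the configuration seen from the point to
which the site is assigned: a point at [s] receives [load (translate s p)]
times its value of [f]. *)
Lemma allocation_identity (f : M -> R) (B : set V) :
  measurable_fun setT f -> (forall p, (0 <= f p)%R) -> measurable B ->
  lam B * \int[nu]_p ((\1_everassigned p)%:E * (f (translate (head lam p) p))%:E) =
  \int[nu]_p \int[p]_(s in B) (load lam (translate s p) * (f (translate s p))%:E).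
Proof.
move=> mf' f0' mB.
have mf : measurable_fun setT (fun p => (f p)%:E) by exact/measurable_EFinP.
have f0 p : 0 <= (f p)%:E by rewrite lee_fin.
pose gk k (z : V * M) : \bar R :=
  (\1_(newly lam k) z.2)%:E * ((\1_(rcball k) z.1)%:E * (f (translate z.1 z.2))%:E).
have i0 (T : Type) (A : set T) (x : T) : 0 <= (\1_A x)%:E :> \bar R.
  by rewrite lee_fin.
have mi d' (T : measurableType d') (A : set T) : measurable A ->
    measurable_fun setT (fun x => (\1_A x)%:E : \bar R).
  by move=> mA; apply/measurable_EFinP; exact: measurable_indic.
have gk0 k z : 0 <= gk k z by rewrite !mule_ge0.
have mrc k : measurable (rcball k : set V) by exact: measurable_cball.
have mnk k : measurable (newly lam k) by exact: measurable_newly.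
have mgk d' (X : measurableType d') (a : X -> V) (q : X -> M) k :
    measurable_fun setT a -> measurable_fun setT q ->
    measurable_fun setT (fun x => gk k (a x, q x)).
  move=> ma mq; apply: emeasurable_funM.
    exact: (measurableT_comp (mi _ _ _ (mnk k)) mq).
  apply: emeasurable_funM; first exact: (measurableT_comp (mi _ _ _ (mrc k)) ma).
  by apply: (measurableT_comp mf); exact: measurable_translate_fun.
pose g z := \sum_(k <oo) gk k z.
have g0 z : 0 <= g z by exact: nneseries_ge0.
have mg : measurable_fun setT g.
  apply: ge0_emeasurable_sum => // k _.
  rewrite (_ : gk k = fun x => gk k (x.1, x.2)); last by apply/funext => -[].
  by apply: mgk; [exact: measurable_fst|exact: measurable_snd].
(* The mass g (s, p) is f (translate s p) if the origin is assigned to s. *)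
have := mass_transport lamT nuT mg g0 mB.
congr (lam B * _ = _).
  apply: eq_integral => p _.
  rewrite integral_nneseries//; last first.
    by move=> k; apply: mgk; [exact: measurable_id|exact: measurable_cst].
  rewrite -series_newly muleC -nneseriesZl//.
  apply: eq_eseriesr => k _ /=; rewrite /gk /= [RHS]muleC.
  have mft : measurable_fun setT (fun s => (f (translate s p))%:E).
    apply: (measurableT_comp mf); apply: measurable_translate_fun.
      exact: measurable_id.
    exact: measurable_cst.
  rewrite ge0_integralZl//; last 2 first.
  - by apply: emeasurable_funM => //; exact: mi.
  - by move=> s _; rewrite mule_ge0.
  rewrite indicE; case: (boolP (p \in newly lam k)) => [|_]; last by rewrite !mul0e.
  rewrite inE => pk; have [kh h1 h0] := headP pk; congr (_ * _).
  rewrite -(@ge0_integral_config1 _ _ p (rcball k) _ (fun s => (f (translate s p))%:E))//.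
  rewrite [RHS]integral_mkcond; apply: eq_integral => s _.
  by rewrite patchE indicE; case: ifPn => _; rewrite ?mul1e ?mul0e.
apply: eq_integral => p _; apply: eq_integral => s _.
set p0 := translate s p.
rewrite integral_nneseries//; last first.
  move=> k; apply: mgk; first by apply: measurable_fun_opprV; exact: measurable_id.
  by apply: measurable_translate_fun; [exact: measurable_id|exact: measurable_cst].
rewrite /load muleC -nneseriesZl//.
apply: eq_eseriesr => k _ /=; rewrite /gk /= [RHS]muleC.
have mr : measurable (region k (newly lam k) p0) by exact: measurable_region.
transitivity (\int[lam]_u ((\1_(region k (newly lam k) p0) u)%:E * (f p0)%:E)).
  apply: eq_integral => u _; rewrite translateK muleA; congr (_ * _).
  rewrite -EFinM; congr EFin; rewrite !indicE -natrM mulnb; congr (_%:R).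
  congr nat_of_bool; apply/andP/idP; rewrite !inE; first by case.
  by move=> [].
rewrite ge0_integralZr//; last exact: mi.
by rewrite integral_indic// setIT.
Qed.

End allocation_identity.

(** * Almost surely the allocation is perfect *)

Section perfect_allocation.
Context (R : realType) (d : nat).
Notation V := 'rV[R]_d.
Notation M := (config R d).
Variable lam : {sigma_finite_measure set V -> \bar R}.
Variable nu : probability M R.
Hypothesis lamT : forall (y : V) (B : set V), measurable B ->
  lam [set x | B (x - y)%R] = lam B.
Hypothesis nuT : forall (y : V) (A : set M), measurable A ->
  nu [set p | A (translate y p)] = nu A.
Hypothesis lam_small : forall e : R, (0 < e)%R -> exists2 r0 : R, (0 < r0)%R &
  forall (z : V) (r : R), (r <= r0)%R -> lam (cball z r) <= e%:E.
Hypothesis lam_fin : forall r : R, lam (cball 0%R r) < +oo.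
Hypothesis lam_gt0 : 0 < lam (cball 0%R 1%R).
Hypothesis nu_mean : forall B : set V, measurable B -> \int[nu]_p (p : M) B = lam B.
Hypothesis nu_simple : {ae nu, forall p : M, p (multiple p) = 0}.
Hypothesis nu_ergodic : forall A : set M, measurable A ->
  (forall y p, A (translate y p) <-> A p) -> nu A = 0 \/ nu A = 1.

Implicit Types (p : M) (s : V).

Let load := load lam.
Let ever := everassigned lam.

(** Locations from which [p], if it has a point there, allocates a volume less
than 1 to that point. *)
Definition deficient (p : M) : set V := [set s | load (translate s p) < 1].

Lemma measurable_load_lt1 : measurable [set p : M | load p < 1].
Proof.
have := @measurable_load _ _ lam measurableT _ (emeasurable_itv `]-oo, 1[).
by rewrite setTI; congr measurable; apply/seteqP; split => pi; rewrite /= in_itv.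
Qed.

Lemma measurable_deficient p : measurable (deficient p).
Proof. exact: (measurable_translate_set p measurable_load_lt1). Qed.

(** The event that some point is deficient. It is translation invariant. *)
Definition has_deficient : set M := [set p : M | p (deficient p) <> 0].

Lemma measurable_has_deficient : measurable has_deficient.
Proof.
have := measurable_config_eval_translate measurable_load_lt1
  (measurableT : measurable (setT : set V)).
move=> /(_ measurableT [set~ 0]); rewrite setTI => h.
have {}h := h (measurableC (emeasurable_set1 0)).
move: h; congr measurable; apply/seteqP.
by split => p; rewrite /has_deficient /= setIT.
Qed.

Lemma has_deficient_translate y p :
  has_deficient (translate y p) <-> has_deficient p.
Proof.
have e : translate y p (deficient (translate y p)) = p (deficient p).
  have <- : [set x | deficient (translate y p) (x - y)%R] = deficient p.
    by apply/seteqP; split => s; rewrite /deficient /= translateD addrC subrK.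
  exact: translateE.
by split => h; [move: h; rewrite /has_deficient /mkset e|rewrite /has_deficient /mkset e].
Qed.

Lemma load_translate_le1 p : p (multiple p) = 0 ->
  p [set s | 1 < load (translate s p)] = 0.
Proof.
move=> pm; apply: (multiple0_null _ pm).
  have := @measurable_load _ _ lam measurableT _ (emeasurable_itv `]1, +oo[).
  rewrite setTI => h; have := measurable_translate_set p h.
  by congr measurable; apply/seteqP; split => s; rewrite /= in_itv /= andbT.
move=> s s1 /=; apply/negP; rewrite -leNgt; apply: load_le1.
by rewrite translate_set1.
Qed.

Lemma has_deficient_assigned p :
  p (multiple p) = 0 -> has_deficient p -> ever p.
Proof.
move=> pm; apply: contra_notP => np.
apply: (multiple0_null _ pm); first exact: measurable_deficient.
move=> s s1; rewrite /deficient /= => ls; apply: np.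
have h0 : translate s p [set 0%R] = 1 by rewrite translate_set1.
have [k] := unfilled_assigned lam_small h0 ls (- s)%R.
by rewrite translateK => hk; exists k.
Qed.

Let mload_translate p : measurable_fun setT (fun s => load (translate s p)).
Proof.
apply: (measurableT_comp (@measurable_load _ _ lam)).
by apply: measurable_translate_fun; [exact: measurable_id|exact: measurable_cst].
Qed.

Lemma integral_load_full p (B : set V) (f : V -> R) : measurable B ->
  measurable_fun setT f -> (forall s, (0 <= f s)%R) ->
  p (multiple p) = 0 -> p (deficient p) = 0 ->
  \int[p]_(s in B) (load (translate s p) * (f s)%:E) = \int[p]_(s in B) (f s)%:E.
Proof.
move=> mB mf f0 pm pd.
have mfE : measurable_fun setT (EFin \o f) by exact/measurable_EFinP.
apply: ge0_ae_eq_integral => //.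
- by apply: measurable_funTS; exact: emeasurable_funM.
- exact: measurable_funTS.
- by move=> s _; rewrite mule_ge0 ?load_ge0 ?lee_fin.
- by move=> s _; rewrite lee_fin.
exists (deficient p `|` [set s | 1 < load (translate s p)]).
have m1 : measurable [set s | 1 < load (translate s p)].
  have := mload_translate p measurableT (emeasurable_itv `]1, +oo[).
  rewrite setTI; congr measurable.
  by apply/seteqP; split => s; rewrite /= in_itv /= andbT.
split.
- by apply: measurableU => //; exact: measurable_deficient.
- apply/eqP; rewrite eq_le measure_ge0 andbT.
  rewrite (le_trans (measureU2 _ _ _))//; first exact: measurable_deficient.
  by rewrite [X in X + _]pd [X in _ + X]load_translate_le1// adde0.
- move=> s /not_implyP[_ h]; rewrite /deficient /=.
  have [l1|l1|l1] := ltgtP (load (translate s p)) 1; [by left|by right|].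
  by exfalso; apply: h; rewrite l1 mul1e.
Qed.

(** The expected volume of the assigned sites in [B] is the expected volume
assigned to the points in [B]. *)
Lemma assigned_balance (B : set V) : measurable B ->
  lam B * nu ever = \int[nu]_p \int[p]_(s in B) load (translate s p).
Proof.
move=> mB.
have m1 : measurable_fun setT (cst 1%R : M -> R) by exact: measurable_cst.
have := allocation_identity lamT nuT m1 (fun=> ler01) mB.
rewrite (eq_integral (fun p => (\1_ever p)%:E)); last by move=> p _; rewrite mule1.
rewrite integral_indic// ?setIT; last exact: measurable_everassigned.
move=> ->; apply: eq_integral => p _; apply: eq_integral => s _; exact: mule1.
Qed.

Lemma probability_setC0 (E : set M) : measurable E -> nu (~` E) = 0 -> nu E = 1.
Proof.
move=> mE E0; have := probability_setC nu (measurableC mE).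
by rewrite setCK E0 sube0.
Qed.

Lemma integral_load_eq (B : set V) : measurable B -> nu has_deficient = 0 ->
  forall f : M -> R, measurable_fun setT f -> (forall p, (0 <= f p)%R) ->
  \int[nu]_p \int[p]_(s in B) (load (translate s p) * (f (translate s p))%:E) =
  \int[nu]_p \int[p]_(s in B) (f (translate s p))%:E.
Proof.
move=> mB hd f mf f0.
have mfE : measurable_fun setT (EFin \o f) by exact/measurable_EFinP.
have f0E p : 0 <= (f p)%:E by rewrite lee_fin.
have lf0 p : 0 <= load p * (f p)%:E by rewrite mule_ge0 ?load_ge0.
have mlf : measurable_fun setT (fun p => load p * (f p)%:E).
  by apply: emeasurable_funM => //; exact: measurable_load.
apply: ge0_ae_eq_integral => //.
- exact: (measurable_config_integral_translate mlf lf0 mB).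
- exact: (measurable_config_integral_translate mfE f0E mB).
- by move=> p _; apply: integral_ge0.
- by move=> p _; apply: integral_ge0.
have nd : {ae nu, forall p, ~ has_deficient p}.
  exists has_deficient; split => //; first exact: measurable_has_deficient.
  by move=> p /= /contrapT.
apply: filterS2 nu_simple nd => p pm pd _; apply: integral_load_full => //.
- apply: (measurableT_comp mf); apply: measurable_translate_fun.
    exact: measurable_id.
  exact: measurable_cst.
- exact: contrapT.
Qed.

(** The volume that a point at the origin lacks. *)
Let short (p : M) : \bar R := 1 - mine (load p) 1.

Let mload : measurable_fun setT load := @measurable_load _ _ lam.

Let load_fin p : mine (load p) 1 \is a fin_num.
Proof.
rewrite ge0_fin_numE; first by rewrite gt_min ltry orbT.
by rewrite le_min load_ge0 lee01.
Qed.

Let short_ge0 p : 0 <= short p.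
Proof. by rewrite /short sube_ge0 ?load_fin// ge_min lexx orbT. Qed.

Let mmin : measurable_fun setT (fun p => mine (load p) 1).
Proof. by apply: measurable_mine => //; exact: measurable_cst. Qed.

Let mshort : measurable_fun setT short.
Proof. by apply: emeasurable_funB => //; exact: measurable_cst. Qed.

Let min_ge0 p : 0 <= mine (load p) 1.
Proof. by rewrite le_min load_ge0 lee01. Qed.

(** If almost surely all sites are assigned, the total volume lacking in a ball is
its volume minus the expected number of its points, that is 0. *)
Lemma short_integral0 (r : R) : nu ever = 1 ->
  \int[nu]_p \int[p]_(s in cball 0%R r) short (translate s p) = 0.
Proof.
move=> ever1; set B := cball _ _.
have mB : measurable B by exact: measurable_cball.
have mtr (p : M) (f : M -> \bar R) : measurable_fun setT f ->
    measurable_fun B (fun s => f (translate s p)).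
  move=> mf; apply: measurable_funTS; apply: (measurableT_comp mf).
  by apply: measurable_translate_fun; [exact: measurable_id|exact: measurable_cst].
have mint (f : M -> \bar R) : measurable_fun setT f -> (forall p, 0 <= f p) ->
    measurable_fun setT (fun p : M => \int[p]_(s in B) f (translate s p)).
  by move=> mf f0; exact: measurable_config_integral_translate.
have e1 : \int[nu]_p \int[p]_(s in B) mine (load (translate s p)) 1 = lam B.
  rewrite -[RHS]mule1 -[X in _ * X]ever1 assigned_balance//.
  apply: ge0_ae_eq_integral => //.
  - exact: (mint _ mmin).
  - by apply: (mint _ mload) => p; exact: load_ge0.
  - by move=> p _; apply: integral_ge0 => s _; exact: min_ge0.
  - by move=> p _; apply: integral_ge0 => s _; exact: load_ge0.
  apply: filterS nu_simple => p pm _; apply: ge0_ae_eq_integral => //.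
  - exact: (mtr _ _ mmin).
  - exact: (mtr _ _ mload).
  - by move=> s _; exact: load_ge0.
  exists [set s | 1 < load (translate s p)]; split.
  - have := mload_translate p measurableT (emeasurable_itv `]1, +oo[).
    rewrite setTI; congr measurable.
    by apply/seteqP; split => s; rewrite /= in_itv /= andbT.
  - exact: load_translate_le1.
  - move=> s /not_implyP[_ h] /=; rewrite ltNge; apply/negP => l1.
    by apply: h; rewrite min_l.
have e2 : lam B + \int[nu]_p \int[p]_(s in B) short (translate s p) = lam B.
  rewrite -{1}e1 -ge0_integralD//; last 4 first.
  - by move=> p _; apply: integral_ge0 => s _; exact: min_ge0.
  - exact: (mint _ mmin).
  - by move=> p _; apply: integral_ge0 => s _; exact: short_ge0.
  - exact: (mint _ mshort).
  rewrite -nu_mean//; apply: eq_integral => p _.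
  rewrite -ge0_integralD//.
  - rewrite (eq_integral (cst 1)) ?integral_cst ?mul1e// => s _.
    by rewrite /short addeC subeK.
  - exact: (mtr _ _ mmin).
  - exact: (mtr _ _ mshort).
have Bfin : lam B \is a fin_num by rewrite ge0_fin_numE// lam_fin.
by rewrite -[LHS](@addeK _ (lam B))// [X in X - _]addeC e2 subee.
Qed.

Lemma nu_has_deficient0 : nu ever = 1 -> nu has_deficient = 0.
Proof.
move=> ever1.
suff : {ae nu, forall p, ~ has_deficient p}.
  move=> [N [mN N0 hN]]; apply: (subset_measure0 _ _ _ N0) => //.
    exact: measurable_has_deficient.
  by move=> p hp; apply: hN => /=; apply.
have h n : {ae nu, forall p : M, p (deficient p `&` cball 0%R n%:R) = 0}.
  set B := cball _ _.
  have mB : measurable B by exact: measurable_cball.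
  have mD : measurable_fun setT
      (fun p : M => \int[p]_(s in B) short (translate s p)).
    exact: measurable_config_integral_translate.
  have : ae_eq nu setT
      (fun p : M => \int[p]_(s in B) short (translate s p)) (cst 0).
    apply/(ae_eq_integral_abs nu measurableT mD).
    rewrite -[RHS](short_integral0 n%:R ever1); apply: eq_integral => p _.
    by rewrite gee0_abs//; exact: integral_ge0.
  apply: filterS => p /(_ I) hp.
  have mst : measurable_fun setT (fun s => short (translate s p)).
    apply: (measurableT_comp mshort); apply: measurable_translate_fun.
      exact: measurable_id.
    exact: measurable_cst.
  have : ae_eq p B (fun s => short (translate s p)) (cst 0).
    apply/(ae_eq_integral_abs p mB (measurable_funTS mst)).
    rewrite -[RHS]hp; apply: eq_integral => s _.
    by rewrite gee0_abs.
  move=> [N [mN N0 hN]]; apply: (subset_measure0 _ _ _ N0) => //.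
    by apply: measurableI => //; exact: measurable_deficient.
  move=> s [sd Bs]; apply: hN => /= /(_ Bs) h0.
  have : 0 < short (translate s p) by rewrite /short min_l ?sube_gt0// ltW.
  by rewrite h0 ltxx.
have : {ae nu, forall p n, p (deficient p `&` cball 0%R n%:R) = 0}.
  exact: ae_foralln.
apply: filterS => p hp; apply.
have -> : deficient p = \bigcup_n (deficient p `&` cball 0%R n%:R).
  by rewrite -setI_bigcupr bigcup_cball_natr setIT.
have mdn n : measurable (deficient p `&` cball 0%R n%:R).
  by apply: measurableI; [exact: measurable_deficient|exact: measurable_cball].
suff : p.-negligible (\bigcup_n (deficient p `&` cball 0%R n%:R)).
  by move/negligibleP; apply; exact: bigcupT_measurable.
apply: negligible_bigcup => n; apply/(negligibleP _ (mdn n)); exact: hp.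
Qed.

(** If no point is deficient then, comparing volumes in a ball, all sites are
assigned; if some point is deficient, all sites are assigned because
otherwise the point would have accepted them, and comparing volumes again shows
that this case has probability 0. *)
Lemma everassigned_as : nu ever = 1 /\ nu has_deficient = 0.
Proof.
have mhd := measurable_has_deficient.
have mever : measurable ever by exact: measurable_everassigned.
suff ever1 : nu ever = 1 by split => //; exact: nu_has_deficient0.
have [h0|h1] := nu_ergodic mhd has_deficient_translate.
  set B : set V := cball 0%R 1%R.
  have mB : measurable B by exact: measurable_cball.
  have Bfin : lam B \is a fin_num by rewrite ge0_fin_numE// lam_fin.
  have e : lam B * nu ever = lam B.
    rewrite assigned_balance// -[RHS]nu_mean//.
    have m1 : measurable_fun setT (cst 1%R : M -> R) by exact: measurable_cst.
    have := integral_load_eq mB h0 m1 (fun=> ler01).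
    under eq_integral do under eq_integral do rewrite mule1.
    move=> ->; apply: eq_integral => p _.
    by rewrite (eq_integral (cst 1))// integral_cst// mul1e.
  have : lam B * nu ever = lam B * 1 by rewrite mule1.
  have efin : nu ever \is a fin_num by exact: fin_num_measure.
  have : (0 < fine (lam B))%R by rewrite fine_gt0// lam_gt0 lam_fin.
  rewrite -(fineK Bfin) -(fineK efin) -!EFinM => b0 [] /mulfI h.
  by rewrite h// gt_eqF.
apply: probability_setC0 => //.
have [N [mN N0 hN]] := nu_simple.
have hd0 : nu (~` has_deficient) = 0 by rewrite probability_setC// h1 subee.
apply: (@subset_measure0 _ _ _ nu _ (N `|` ~` has_deficient)).
- exact: measurableC.
- by apply: measurableU => //; exact: measurableC.
- move=> p np; have [pm|pm] := pselect (p (multiple p) = 0).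
    by right => hd; apply: np; exact: has_deficient_assigned.
  by left; apply: hN.
apply/eqP; rewrite eq_le measure_ge0 andbT (le_trans (measureU2 _ _ _))//.
  exact: measurableC.
by rewrite [X in X + _]N0 [X in _ + X]hd0 adde0.
Qed.

(** The configuration seen from the point of the origin satisfies the equation
of the Palm law. *)
Lemma head_palm_identity (f : M -> R) (B : set V) :
  measurable_fun setT f -> (forall p, (0 <= f p)%R) -> measurable B ->
  \int[nu]_p \int[p]_(s in B) (f (translate s p))%:E =
  lam B * \int[nu]_p (f (translate (head lam p) p))%:E.
Proof.
move=> mf f0 mB; have [ever1 hd0] := everassigned_as.
rewrite -integral_load_eq// -allocation_identity//; congr (_ * _).
have mever : measurable ever by exact: measurable_everassigned.
have mfh : measurable_fun setT (fun p : M => (f (translate (head lam p) p))%:E).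
  apply/measurable_EFinP; apply: (measurableT_comp mf).
  apply: measurable_translate_fun; last exact: measurable_id.
  exact: measurable_head.
apply: ge0_ae_eq_integral => //.
- apply: emeasurable_funM => //; apply/measurable_EFinP.
  exact: measurable_indic.
- by move=> p _; rewrite mule_ge0 ?lee_fin.
- by move=> p _; rewrite lee_fin.
exists (~` ever); split.
- exact: measurableC.
- by have := probability_setC nu mever; rewrite ever1 subee.
- move=> p /not_implyP[_ h] pe; apply: h.
  by rewrite indicE mem_set// mul1e.
Qed.

End perfect_allocation.

(** * The mean measure of the process *)

Section mean_measure.
Context (R : realType) (d : nat).
Notation V := 'rV[R]_d.
Notation M := (config R d).
Variable nu : probability M R.

(** The expected mass of [B]; it is countably additive on Borel sets by monotone
convergence. *)
Definition mean_measure (B : set V) : \bar R := \int[nu]_p (p : M) B.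

Let mean_measure0 : mean_measure set0 = 0.
Proof. by apply: integral0_eq => p _; rewrite measure0. Qed.

Let mean_measure_ge0 B : 0 <= mean_measure B.
Proof. by apply: integral_ge0 => p _. Qed.

Let mean_measure_sigma_additive : semi_sigma_additive mean_measure.
Proof.
move=> F mF tF mUF.
have -> : mean_measure (\bigcup_n F n) = \sum_(n <oo) mean_measure (F n).
  rewrite /mean_measure -integral_nneseries//; last first.
    by move=> n; exact: measurable_config_eval.
  apply: eq_integral => p _; apply/esym/cvg_lim => //.
  exact: measure_semi_sigma_additive.
by apply: is_cvg_nneseries => n _ _; exact: mean_measure_ge0.
Qed.

HB.instance Definition _ := isMeasure.Build _ _ _ mean_measure
  mean_measure0 mean_measure_ge0 mean_measure_sigma_additive.

Hypothesis nuT : forall (y : V) (A : set M), measurable A ->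
  nu [set p | A (translate y p)] = nu A.

Lemma mean_measureT (y : V) (B : set V) : measurable B ->
  mean_measure [set x | B (x - y)%R] = mean_measure B.
Proof.
move=> mB; rewrite /mean_measure -[RHS](ge0_integral_nuT nuT y)//.
exact: measurable_config_eval.
Qed.

Lemma mean_measure_cball (z : V) (r : R) :
  mean_measure (cball z r) = mean_measure (cball 0%R r).
Proof.
rewrite -[RHS](mean_measureT z (@measurable_cball _ _ _ _)); congr mean_measure.
by apply/seteqP; split => x; rewrite /cball /= subr0.
Qed.

Hypothesis nu_intensity : forall B : set V, measurable B ->
  mean_measure B = lebesgue_rV B.

Lemma mean_measure_cballE (z : V) (r : R) : (0 <= r)%R ->
  mean_measure (cball z r) = ((2 * r) ^+ d)%:E.
Proof.
move=> r0; rewrite mean_measure_cball nu_intensity; last exact: measurable_cball.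
exact: lebesgue_rV_cball0.
Qed.

Lemma mean_measure_small : (0 < d)%N ->
  forall e : R, (0 < e)%R -> exists2 r0 : R, (0 < r0)%R &
  forall (z : V) (r : R), (r <= r0)%R -> mean_measure (cball z r) <= e%:E.
Proof.
move=> d0 e e0.
have r0 : (0 < Num.min 2^-1 (e / 2))%R by rewrite lt_min invr_gt0 ltr0n/= divr_gt0.
exists (Num.min 2^-1 (e / 2))%R => // z r rle.
apply: (@le_trans _ _ (mean_measure (cball z (Num.min 2^-1 (e / 2))%R))).
  apply: le_measure; rewrite ?inE; [exact: measurable_cball|exact: measurable_cball|].
  by move=> x; rewrite /cball /= => h; apply: le_trans rle.
rewrite (mean_measure_cballE _ (ltW r0)) lee_fin.
set t : R := (Num.min _ _)%R.
have t1 : (t <= 2^-1)%R by rewrite ge_min lexx.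
have t2 : (t <= e / 2)%R by rewrite ge_min lexx orbT.
apply: (@le_trans _ _ (2 * t)%R); last by lra.
rewrite -[leRHS]expr1; apply: ler_wiXn2l => //.
  by rewrite mulr_ge0// ltW.
by lra.
Qed.

Lemma mean_measure_fin (r : R) : mean_measure (cball 0%R r) < +oo.
Proof.
have [r0|r0] := leP 0%R r; first by rewrite mean_measure_cballE// ltry.
rewrite (_ : cball _ _ = set0) ?mean_measure0 ?ltry//.
apply/seteqP; split => // x; rewrite /cball /= => h.
by have := le_lt_trans h r0; rewrite ltNge normr_ge0.
Qed.

Let mean_measure_sigma_finite : sigma_finite setT mean_measure.
Proof.
exists (fun n => cball 0%R n%:R); first by rewrite bigcup_cball_natr.
by move=> n; split; [exact: measurable_cball|exact: mean_measure_fin].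
Qed.

(** The mean measure, as a sigma-finite measure. *)
Definition mean_measure_sf : {sigma_finite_measure set V -> \bar R} :=
  HB.pack mean_measure
    (isSFinite.Build _ _ _ mean_measure
      (sfinite_measure_sigma_finite mean_measure_sigma_finite))
    (isSigmaFinite.Build _ _ _ mean_measure mean_measure_sigma_finite).

End mean_measure.

(** * The Palm law and the extra head scheme *)

Section palm_of_nonneg.
Context (R : realType) (d : nat) (disp : measure_display)
  (Omega : measurableType disp) (P : probability Omega R).
Notation V := 'rV[R]_d.
Notation M := (config R d).

(** It suffices to verify the equation of the Palm law on nonnegative functions:
a bounded [f] is the difference of its positive and negative parts, whose
integrals over a set of finite volume are finite. *)
Lemma palm_law_nonneg (Pi : {RV P >-> M}) (L : probability M R) :
  unit_intensity Pi ->
  (forall (f : M -> R) (B : set V), measurable_fun setT f ->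
    (forall p, (0 <= f p)%R) -> measurable B ->
    \int[P]_w \int[Pi w]_(s in B) (f (translate s (Pi w)))%:E =
    lebesgue_rV B * \int[L]_p (f p)%:E) ->
  palm_law Pi L.
Proof.
move=> uPi hL f B mf [K fK] mB [f0|Bfin]; first exact: hL.
have mfE : measurable_fun setT (EFin \o f) by exact/measurable_EFinP.
pose f1 p : R := Num.max (f p) 0%R; pose f2 p : R := Num.max (- f p)%R 0%R.
have mf1 : measurable_fun setT f1.
  by apply: measurable_maxr => //; exact: measurable_cst.
have mf2 : measurable_fun setT f2.
  apply: measurable_maxr; last exact: measurable_cst.
  exact: measurableT_comp.
have f10 p : (0 <= f1 p)%R by rewrite le_max lexx orbT.
have f20 p : (0 <= f2 p)%R by rewrite le_max lexx orbT.
have K0 : (0 <= K)%R by apply: le_trans (fK point).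
have f1K p : (f1 p <= K)%R.
  by rewrite ge_max K0 andbT (le_trans _ (fK p))// ler_norm.
have f2K p : (f2 p <= K)%R.
  by rewrite ge_max K0 andbT (le_trans _ (fK p))// -normrN ler_norm.
have splitf d' (X : measurableType d') (mu : {measure set X -> \bar R})
    (D : set X) (q : X -> M) :
    \int[mu]_(x in D) (f (q x))%:E =
    \int[mu]_(x in D) (f1 (q x))%:E - \int[mu]_(x in D) (f2 (q x))%:E.
  rewrite integralE; congr (_ - _); apply: eq_integral => x _.
    by rewrite funeposE /f1 EFin_max.
  by rewrite funenegE /f2 EFin_max.
have fin (g : M -> R) : measurable_fun setT g -> (forall p, (0 <= g p)%R) ->
    (forall p, (g p <= K)%R) -> \int[L]_p (g p)%:E \is a fin_num.
  move=> mg g0 gK; rewrite ge0_fin_numE; last first.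
    by apply: integral_ge0 => p _; rewrite lee_fin.
  apply: (@le_lt_trans _ _ (\int[L]_p (cst K%:E p))).
    apply: ge0_le_integral => //.
    - by move=> p _; rewrite lee_fin.
    - exact/measurable_EFinP.
    - by move=> p _; rewrite lee_fin.
  by rewrite integral_cst// [X in _ * X]probability_setT mule1 ltry.
have B0 : 0 <= lebesgue_rV B by rewrite -uPi//; exact: integral_ge0.
have Bfin' : lebesgue_rV B \is a fin_num by rewrite ge0_fin_numE.
have inte (g : M -> R) : measurable_fun setT g -> (forall p, (0 <= g p)%R) ->
    (forall p, (g p <= K)%R) ->
    P.-integrable setT (fun w => \int[Pi w]_(s in B) (g (translate s (Pi w)))%:E).
  move=> mg g0 gK; apply/integrableP; split.
    have mgE : measurable_fun setT (EFin \o g) by exact/measurable_EFinP.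
    have g0E p : 0 <= (g p)%:E by rewrite lee_fin.
    exact: (measurableT_comp (measurable_config_integral_translate mgE g0E mB)).
  rewrite (eq_integral (fun w => \int[Pi w]_(s in B) (g (translate s (Pi w)))%:E)).
    2: by move=> w _; rewrite gee0_abs//; apply: integral_ge0 => s _; rewrite lee_fin.
  rewrite hL// ltey_eq fin_numM//; exact: fin.
rewrite splitf muleBr//; last by rewrite fin_num_adde_defl// fin_numN; exact: fin.
rewrite -!hL// -integralB//; [|exact: inte|exact: inte].
by apply: eq_integral => w _; exact: splitf.
Qed.

End palm_of_nonneg.

Theorem theorem1 (R : realType) (d : nat) (d_gt0 : (0 < d)%N)
    (disp : measure_display) (Omega : measurableType disp)
    (P : probability Omega R) (Pi : {RV P >-> config R d}) :
  simple_process Pi -> unit_intensity Pi ->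
  translation_invariant Pi -> ergodic Pi ->
  exists2 Y : {RV P >-> 'rV[R]_d}, extra_head_scheme Pi Y & nonrandomized Pi Y.
Proof.
move=> sPi uPi tPi ePi.
pose nu : probability (config R d) R := distribution P Pi.
have mPi : measurable_fun setT Pi by [].
have nuT (y : 'rV[R]_d) (A : set (config R d)) : measurable A ->
    nu [set p | A (translate y p)] = nu A by move=> mA; exact: tPi.
have nuE (f : config R d -> \bar R) : measurable_fun setT f ->
    (forall p, 0 <= f p) -> \int[nu]_p f p = \int[P]_w f (Pi w).
  by move=> mf f0; exact: ge0_integral_distribution.
have nuI (B : set 'rV[R]_d) : measurable B -> mean_measure nu B = lebesgue_rV B.
  by move=> mB; rewrite -uPi//; apply: nuE => //; exact: measurable_config_eval.
pose lam := mean_measure_sf nuT nuI.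
have nuS : {ae nu, forall p : config R d, p (multiple p) = 0}.
  pose S := [set p : config R d | p (multiple p) <> 0].
  have mS : measurable S.
    have mz := measurableC (emeasurable_set1 (0 : \bar R)).
    have := @measurable_eval_multiple R d measurableT _ mz.
    by rewrite setTI.
  have mPS : measurable (Pi @^-1` S) by rewrite -[X in measurable X]setTI; exact: mPi.
  exists S; split => //.
  have [N [mN N0 hN]] := sPi.
  apply: (subset_measure0 mPS mN _ N0).
  by move=> w Sw; apply: hN => /= /simple_multiple.
have lam1 : 0 < lam (cball 0%R 1%R).
  by rewrite [ltRHS](mean_measure_cballE nuT nuI)// lte_fin exprn_gt0// mulr1.
have pal := head_palm_identity (lam := lam) (mean_measureT nuT) nuT
  (mean_measure_small nuT nuI d_gt0) (mean_measure_fin nuT nuI) lam1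
  (fun B _ => erefl) nuS ePi.
have mh := measurable_head lam.
have mY : measurable_fun setT (fun w => head lam (Pi w)).
  exact: (measurableT_comp mh mPi).
pose Y : {RV P >-> 'rV[R]_d} := HB.pack (fun w => head lam (Pi w))
  (isMeasurableFun.Build _ _ _ _ _ mY).
have mT : measurable_fun setT (fun w => translate (Y w) (Pi w)).
  exact: measurable_translate_fun.
pose T : {RV P >-> config R d} := HB.pack (fun w => translate (Y w) (Pi w))
  (isMeasurableFun.Build _ _ _ _ _ mT).
exists Y; last by exists (head lam) => //; exact: nearW.
split => //; exists (distribution P T) => //.
apply: palm_law_nonneg => // f B mf f0 mB.
have mfE : measurable_fun setT (EFin \o f) by exact/measurable_EFinP.
have f0E p : 0 <= (f p)%:E by rewrite lee_fin.
rewrite -nuI// ge0_integral_distribution//.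
have := pal f B mf f0 mB.
rewrite nuE//; last 2 first.
- exact: (measurable_config_integral_translate mfE f0E mB).
- by move=> p; apply: integral_ge0.
move=> ->; congr (_ * _); rewrite nuE//.
apply: (measurableT_comp mfE); apply: measurable_translate_fun => //.
Qed.
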